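(* For any Young diagram $\lambda$ and any positive integer $k$, we have $$\sum_{T \in \mathcal{T}_{\lambda}(I_k)}t^{\mathrm{Peak}(T)} = \sum_{T \in \mathcal{T}_{\lambda}(I_k)}t^{\mathrm{Val}(T)} = \sum_{T \in \mathcal{T}_{\lambda}(J_k)}t^{\mathrm{Val}(T)} = \sum_{T \in \mathcal{T}_{\lambda}(J_k)}t^{\mathrm{Peak}(T)}.$$
   Context: Young diagrams are identified with integer partitions and drawn left-justified; the square $(i,j)$ is the square in the $i$-th column (columns numbered left to right) and $j$-th row (rows numbered top to bottom). $c_j(\lambda)$ denotes the length of the $j$-th column of $\lambda$. A transversal $T$ of shape $\lambda$ is a $01$-filling of the squares of $\lambda$ such that each row and each column contains exactly one $1$. If $\lambda$ has $n$ columns, write $T=t_1t_2\cdots t_n$, where the $1$ in column $i$ is in the square $(i,t_i)$. $\mathcal{T}_\lambda$ is the set of transversals of shape $\lambda$. An index $i$ with $2\le i\le n-1$ and $c_{i-1}(\lambda)=c_i(\lambda)=c_{i+1}(\lambda)$ is a peak of $T$ if $t_{i-1}<t_i>t_{i+1}$ and a valley of $T$ if $t_{i-1}>t_i<t_{i+1}$. $\mathrm{Peak}(T)$ and $\mathrm{Val}(T)$ are the sets of peaks and of valleys of $T$. $T$ contains a pattern $\sigma\in\mathcal{S}_m$ (a permutation of $\{1,\dots,m\}$) if there are rows $r_1<\cdots<r_m$ and columns $c_1<\cdots<c_m$ such that every square $(c_i,r_j)$ lies in $\lambda$ and the restriction of $T$ to these rows and columns is the permutation matrix of $\sigma$ (i.e.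 the $1$'s are exactly in squares $(c_i,r_{\sigma_i})$). Otherwise $T$ avoids $\sigma$. $\mathcal{T}_\lambda(\sigma)$ is the set of $\sigma$-avoiding transversals of shape $\lambda$. $I_k=12\cdots k$ and $J_k=k\cdots 21$. For a finite set $A$ of positive integers, $t^A=\prod_{i\in A}t_i$ with $t_1,t_2,\ldots$ commuting indeterminates, and $t^{\emptyset}=1$. *)

(* Defs.v *)
From HB Require Import structures.
From mathcomp Require Import all_boot all_order all_algebra all_fingroup.
From mathcomp Require Export mpoly.

Set Implicit Arguments.
Unset Strict Implicit.
Unset Printing Implicit Defensive.

(* Rows and columns are numbered from 0: index i stands for i + 1 on paper.   *)

Definition is_partition (la : seq nat) : bool :=
  sorted geq la && (0 \notin la).

Definition nrows (la : seq nat) : nat := size la.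
Definition ncols (la : seq nat) : nat := head 0 la.

(* Squares are pairs (column, row) in the bounding box of the diagram.        *)
Definition box (la : seq nat) : finType := ('I_(ncols la) * 'I_(nrows la))%type.

Definition diagram (la : seq nat) : {set box la} :=
  [set s : box la | s.1 < nth 0 la s.2].

Definition col_len (la : seq nat) (i : nat) : nat :=
  count (fun r => i < r) la.

Section Transversals.
Variable la : seq nat.

(* A 01-filling of the squares of la is given by the set of squares that      *)
(* contain a 1.                                                               *)
Definition transversals : {set {set box la}} :=
  [set T : {set box la} |
    [&& T \subset diagram la,
        [forall i : 'I_(ncols la), #|[set s in T | s.1 == i]| == 1]
      & [forall j : 'I_(nrows la), #|[set s in T | s.2 == j]| == 1]]].

(* When T is a transversal and i < ncols la, the sum has exactly one term.    *)
Definition one_row (T : {set box la}) (i : nat) : nat :=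
  \sum_(s in T | s.1 == i :> nat) s.2.

Definition flat_at (i : nat) : bool :=
  [&& 0 < i, i.+1 < ncols la, col_len la i.-1 == col_len la i
    & col_len la i == col_len la i.+1].

Definition Peak (T : {set box la}) : {set 'I_(ncols la)} :=
  [set i : 'I_(ncols la) |
    [&& flat_at i, one_row T i.-1 < one_row T i
      & one_row T i > one_row T i.+1]].

Definition Val (T : {set box la}) : {set 'I_(ncols la)} :=
  [set i : 'I_(ncols la) |
    [&& flat_at i, one_row T i.-1 > one_row T i
      & one_row T i < one_row T i.+1]].

Definition contains (m : nat) (sigma : 'S_m) (T : {set box la}) : bool :=
  [exists r : {ffun 'I_m -> 'I_(nrows la)},
   exists c : {ffun 'I_m -> 'I_(ncols la)},
    [&& [forall i : 'I_m, forall j : 'I_m, (i < j) ==> (r i < r j)],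
        [forall i : 'I_m, forall j : 'I_m, (i < j) ==> (c i < c j)],
        [forall i, forall j, (c i, r j) \in diagram la]
      & [forall i, forall j, ((c i, r j) \in T) == (j == sigma i)]]].

Definition avoiders (m : nat) (sigma : 'S_m) : {set {set box la}} :=
  [set T in transversals | ~~ contains sigma T].

End Transversals.

Definition Ipat (k : nat) : 'S_k := 1%g.
Definition Jpat (k : nat) : 'S_k := perm (@rev_ord_inj k).

Definition tmon (n : nat) (A : {set 'I_n}) : {mpoly int[n]} :=
  (\prod_(i in A) 'X_i)%R.

(* Main.v *)
(** A transversal is read as the word of the columns of its 1s, from the top row
    down.  An occurrence of I_k is an increasing k-chain of this word; an
    occurrence of J_k is a decreasing k-chain whose columns all meet the row of its
    last letter.

    By inclusion-exclusion on ascents and descents it is enough to count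
    transversals with prescribed descents for I_k (ascents for J_k) inside runs
    of equal columns.  Merging the columns linked by such constraints turns these
    into fillings with prescribed column sums, built by adding columns and
    deleting full rows.  For J_k, reversing the order of the columns turns
    decreasing chains into increasing ones and appended columns into prepended
    ones.  So everything follows if a filling count depends neither on the side
    on which columns are added nor on the order of the column sums in a run.

    Both facts come from crystal operators on words.  They preserve the existence
    of increasing chains through every window of rows, and hence every function
    h ("good" below) that counts the ways to complete a partial filling.  The
    sums of h over the words of given content are symmetric in the content.  By a
    Gessel-Zeilberger reflection they determine the sums of h over ballot words
    of given content, unitriangularly, and a ballot word has an increasing
    k-chain exactly when it contains the k-th letter.  Therefore the avoidance
    condition acts on the content sums by universal coefficients, and each
    construction step acts in the same way for appended and for prepended
    columns.

    Finally, permuting the column sums within a run gives that a segment of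
    constraints may be reversed; the constraints of a maximal chain of peaks are
    (ascent, descent)^l, and reversing them gives those of valleys. *)
Require Import Defs.
From mathcomp Require Import all_boot all_order all_algebra all_fingroup.
From mathcomp Require Import mpoly.
From mathcomp Require Import zify.

Set Implicit Arguments.
Unset Strict Implicit.
Unset Printing Implicit Defensive.

Import GRing.Theory.


(** * Bracket flips *)

Definition occ (a : nat) (s : seq nat) : nat := count_mem a s.

Arguments occ : simpl never.

Lemma occ_nil a : occ a [::] = 0. Proof. by []. Qed.
Lemma occ_cons a x s : occ a (x :: s) = (x == a) + occ a s. Proof. by []. Qed.
Lemma occ_cat a s t : occ a (s ++ t) = occ a s + occ a t.
Proof. exact: count_cat. Qed.
Lemma occ_rcons a s x : occ a (rcons s x) = occ a s + (x == a).
Proof. by rewrite -cats1 occ_cat /occ /= addn0. Qed.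
Lemma occ_rev a s : occ a (rev s) = occ a s.
Proof. exact: count_rev. Qed.
Definition occE := (occ_nil, occ_cons, occ_cat, occ_rcons).

Lemma cat_cons_cmp (A : Type) (s t s' t' : seq A) x x' :
  s ++ x :: t = s' ++ x' :: t' ->
  [\/ [/\ s = s', x = x' & t = t'],
      exists2 u, s' = s ++ x :: u & t = u ++ x' :: t'
    | exists2 u, s = s' ++ x' :: u & t' = u ++ x :: t].
Proof.
elim: s s' => [|y s IH] [|y' s'] /=.
- by case=> -> ->; constructor 1.
- by case=> -> ->; constructor 2; exists s'.
- by case=> -> <-; constructor 3; exists s.
case=> -> /IH [[-> -> ->]|[u -> ->]|[u -> ->]].
- by constructor 1.
- by constructor 2; exists u.
- by constructor 3; exists u.
Qed.

Lemma cat_cmp (A : Type) (s t s' t' : seq A) :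
  s ++ t = s' ++ t' ->
  (exists2 u, s' = s ++ u & t = u ++ t') \/ (exists2 u, s = s' ++ u & t' = u ++ t).
Proof.
elim: s s' => [|y s IH] [|y' s'] /=.
- by move=> ->; left; exists [::].
- by move=> ->; left; exists (y' :: s').
- by move=> <-; right; exists (y :: s).
by case=> -> /IH [[u -> ->]|[u -> ->]]; [left|right]; exists u.
Qed.

Section Flips.
Variables p q : nat.

(* Read p as an opening and q as a closing bracket: in [bal] words every q is
   matched, in [anti] words every p is. *)
Definition bal (t : seq nat) :=
  forall u w, t = u ++ w -> occ q u <= occ p u.
Definition anti (s : seq nat) :=
  forall u w, s = u ++ w -> occ p w <= occ q w.

(* The first unmatched p becomes an unmatched q (a crystal operator). *)
Definition flip (b b' : seq nat) :=
  exists s t, [/\ b = s ++ p :: t, b' = s ++ q :: t, anti s & bal t].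

Lemma bal_nil : bal [::]. Proof. by case. Qed.
Lemma anti_nil : anti [::]. Proof. by case=> [|? ?] [|? ?]. Qed.

Lemma bal_catl s t : bal (s ++ t) -> bal s.
Proof. by move=> B u w E; apply: (B u (w ++ t)); rewrite E catA. Qed.

Lemma bal_cat s t : bal s -> bal t -> bal (s ++ t).
Proof.
move=> Bs Bt u w /cat_cmp [[x -> Et]|[x Es _]].
  rewrite !occE; have := Bs s [::]; have := Bt x w Et.
  by rewrite cats0 => h1 /(_ erefl) h2; apply: leq_add.
exact: Bs Es.
Qed.

Lemma anti_cat s t : anti s -> anti t -> anti (s ++ t).
Proof.
move=> Bs Bt u w /cat_cmp [[x _ Et]|[x Es ->]].
  exact: Bt Et.
by rewrite !occE; have := Bs u x Es; have := Bt [::] t erefl; lia.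
Qed.

Lemma bal1 (x : nat) : x != q -> bal [:: x].
Proof. by move=> xq [|y [|//]] w //= [<- _]; rewrite !occE (negbTE xq). Qed.

Lemma anti1 (x : nat) : x != p -> anti [:: x].
Proof.
move=> xp [|y u] [|z w] //= [].
  by move=> <- <-; rewrite !occE (negbTE xp).
by move=> _ /esym/(congr1 size); rewrite size_cat /= addnS.
Qed.

Lemma bal_cons (x : nat) t : x != q -> bal t -> bal (x :: t).
Proof. by move=> xq Bt; apply: (@bal_cat [:: x]) => //; apply: bal1. Qed.

Lemma anti_rcons (x : nat) t : x != p -> anti t -> anti (rcons t x).
Proof. by move=> xp Bt; rewrite -cats1; apply: anti_cat => //; apply: anti1. Qed.

Lemma anti_balanced s : anti s -> occ q s <= occ p s -> bal s.
Proof.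
move=> As le u w E; have := As u w E; move: le; rewrite E !occE; lia.
Qed.

Lemma bal_balanced s : bal s -> occ q s <= occ p s ->
  occ p s <= occ q s -> anti s.
Proof.
move=> As le le' u w E; have := As u w E; move: le le'; rewrite E !occE; lia.
Qed.

Lemma anti_cons_neq (x : nat) s : x != p -> anti s -> anti (x :: s).
Proof. by move=> xp; apply: (@anti_cat [:: x]); apply: anti1. Qed.

Hypothesis pq : p != q.

Lemma anti_cons_lt s : anti s -> occ p s < occ q s -> anti (p :: s).
Proof.
move=> As lt [|x u] w /=; last by case=> _; apply: As.
by move=> <-; rewrite !occE eqxx (negbTE pq); lia.
Qed.


(** Induction on the word from its front: a new [p] is absorbed when the part before the current
    flip site has a surplus of [q]; otherwise that part is balanced, and the new [p] becomes the
    first unmatched one. *)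
Lemma anti_or_flip b :
  anti b \/ exists s t, [/\ b = s ++ p :: t, anti s & bal t].
Proof.
elim: b => [|x b IH]; first by left; exact: anti_nil.
have [->|xp] := eqVneq x p; last first.
  case: IH => [A|[s [t [-> A B]]]]; first by left; apply: anti_cons_neq.
  by right; exists (x :: s), t; split=> //; apply: anti_cons_neq.
case: IH => [A|[s [t [-> A B]]]].
  have [lt|le] := ltnP (occ p b) (occ q b).
    by left; apply: anti_cons_lt.
  by right; exists [::], b; split=> //; [exact: anti_nil|exact: anti_balanced].
have [lt|le] := ltnP (occ p s) (occ q s).
  by right; exists (p :: s), t; split=> //; apply: anti_cons_lt.
right; exists [::], (s ++ p :: t); split=> //; first exact: anti_nil.
by apply: bal_cat; [exact: anti_balanced|exact: bal_cons].
Qed.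

(** Two different flip sites would enclose a factor [u] such that [anti] forces more [q] than [p] in
    [u], while [bal] forces the opposite. *)
Lemma flip_fun b b1 b2 : flip b b1 -> flip b b2 -> b1 = b2.
Proof.
move=> [s [t [-> -> As Bt]]] [s' [t' [E -> As' Bt']]].
case: (cat_cons_cmp E) => [[-> _ ->]//|[u Es Et]|[u Es Et]]; exfalso.
- have := As' s (p :: u) Es; have := Bt u _ Et.
  by rewrite !occE eqxx (negbTE pq); lia.
have := As s' (p :: u) Es; have := Bt' u _ Et.
by rewrite !occE eqxx (negbTE pq); lia.
Qed.

(** The flipped letter can be recognised in the image: it is the last unmatched [q]. *)
Lemma flip_inj b1 b2 b : flip b1 b -> flip b2 b -> b1 = b2.
Proof.
move=> [s [t [-> -> As Bt]]] [s' [t' [-> E As' Bt']]].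
have qp : (q == p) = false by rewrite eq_sym (negbTE pq).
case: (cat_cons_cmp E) => [[-> _ ->]//|[u Es Et]|[u Es Et]]; exfalso.
- have := As' (s ++ [:: q]) u; rewrite -catA => /(_ Es).
  have := Bt (u ++ [:: q]) t'; rewrite -catA => /(_ Et).
  by rewrite !occE eqxx qp; lia.
have := As (s' ++ [:: q]) u; rewrite -catA => /(_ Es).
have := Bt' (u ++ [:: q]) t; rewrite -catA => /(_ Et).
by rewrite !occE eqxx qp; lia.
Qed.

Fixpoint flips k (b b' : seq nat) : Prop :=
  if k is k1.+1 then exists2 c, flip b c & flips k1 c b' else b = b'.

Lemma flips_rcons k b c b' : flips k b c -> flip c b' -> flips k.+1 b b'.
Proof.
elim: k b => [|k IH] b /=; first by move=> -> f; exists b'.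
by case=> d f1 f2 f3; exists d => //; apply: IH.
Qed.

Lemma flips_fun k b b1 b2 : flips k b b1 -> flips k b b2 -> b1 = b2.
Proof.
elim: k b => [|k IH] b /=; first by move=> -> ->.
by move=> [c f1 f2] [d g1 g2]; move: f2; rewrite (flip_fun f1 g1) => /IH; apply.
Qed.

Lemma flips_inj k b1 b2 b : flips k b1 b -> flips k b2 b -> b1 = b2.
Proof.
elim: k b1 b2 => [|k IH] b1 b2 /=; first by move=> -> ->.
move=> [c f1 f2] [d g1 g2]; move: f1; rewrite (IH _ _ f2 g2) => f1.
exact: flip_inj f1 g1.
Qed.

Lemma flips_exists k b : occ q b + k <= occ p b ->
  exists b', flips k b b'.
Proof.
(* Successive flips move to the right: after a flip the prefix up to and including the new [q] is
   again [anti], so the next site is sought in the remaining suffix only. *)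
suff H : forall k s t, anti s -> occ q t + k <= occ p t ->
    exists b', flips k (s ++ t) b'.
  by apply: (H k [::]); apply: anti_nil.
elim=> [|{}k IH] s t As; first by exists (s ++ t).
move=> le; case: (anti_or_flip t) => [At|[s2 [t2 [Et As2 Bt2]]]].
  by have := At [::] t erefl; lia.
have [||b' f] := IH (rcons (s ++ s2) q) t2.
- by apply: anti_rcons; [rewrite eq_sym|apply: anti_cat].
- move: le; rewrite Et !occE eqxx (negbTE pq).
  by have := As2 [::] s2 erefl; lia.
exists b', (rcons (s ++ s2) q ++ t2) => //.
exists (s ++ s2), t2; rewrite Et catA cat_rcons; split=> //.
exact: anti_cat.
Qed.

Lemma flip_count b b' a : flip b b' ->
  occ a b' + (a == p) = occ a b + (a == q).
Proof.
clear pq; move=> [s [t [-> -> _ _]]]; rewrite !occE (eq_sym q) (eq_sym p); lia.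
Qed.

Lemma flips_count k b b' a : flips k b b' ->
  occ a b' + k * (a == p) = occ a b + k * (a == q).
Proof.
clear pq; elim: k b => [|k IH] b /=; first by move=> ->; rewrite !mul0n.
by case=> c /(flip_count a) E1 /IH E2; lia.
Qed.

Lemma flip_size b b' : flip b b' -> size b' = size b.
Proof. by move=> [s [t [-> -> _ _]]]; rewrite !size_cat. Qed.

Lemma flips_size k b b' : flips k b b' -> size b' = size b.
Proof.
by elim: k b => [|k IH] b /=; [move=> -> | case=> c /flip_size <- /IH].
Qed.

Lemma flips_all k b b' (P : pred nat) : P p -> P q -> flips k b b' -> all P b' = all P b.
Proof.
move=> Pp Pq; elim: k b => [|k IH] b /=; first by move=> ->.
by case=> c [s [t [-> -> _ _]]] /IH ->; rewrite !all_cat /= Pp Pq.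
Qed.

End Flips.

Lemma anti_rev p q s : anti p q s -> bal q p (rev s).
Proof.
move=> A u w E; have := A (rev w) (rev u); rewrite !occ_rev; apply.
by rewrite -rev_cat -E revK.
Qed.

Lemma bal_rev p q s : bal p q s -> anti q p (rev s).
Proof.
move=> A u w E; have := A (rev w) (rev u); rewrite !occ_rev; apply.
by rewrite -rev_cat -E revK.
Qed.

Lemma flip_rev p q b b' : flip q p b b' -> flip p q (rev b') (rev b).
Proof.
move=> [s [t [-> -> As Bt]]]; exists (rev t), (rev s).
rewrite !rev_cat !rev_cons !cat_rcons; split=> //.
  exact: bal_rev.
exact: anti_rev.
Qed.

Lemma flips_rev p q k b b' : flips q p k b b' -> flips p q k (rev b') (rev b).
Proof.
elim: k b => [|k IH] b; first by move=> /= ->.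
by move=> [c /flip_rev f /IH g]; apply: flips_rcons g f.
Qed.

(* Exchanges the numbers of unmatched p's and q's. *)
Definition breflect p q (b b' : seq nat) :=
  if occ q b <= occ p b
  then flips p q (occ p b - occ q b) b b'
  else flips p q (occ q b - occ p b) b' b.

Section Reflect.
Variables p q : nat.
Hypothesis pq : p != q.
Let qp : (q == p) = false. Proof. by rewrite eq_sym (negbTE pq). Qed.

Lemma breflect_total b : exists b', breflect p q b b'.
Proof.
rewrite /breflect; case: leqP => le.
  by apply: flips_exists => //; lia.
(* A preimage under flips is needed here; reversing words turns inverse flips into flips with the
   two brackets exchanged. *)
have [|b' f] := @flips_exists q p (negbT qp) (occ q b - occ p b) (rev b).
  by rewrite !occ_rev; lia.
by exists (rev b'); have := flips_rev f; rewrite revK.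
Qed.

Lemma breflect_fun b b1 b2 : breflect p q b b1 -> breflect p q b b2 -> b1 = b2.
Proof.
rewrite /breflect; case: leqP => le; [exact: flips_fun|exact: flips_inj].
Qed.

Lemma breflect_countp b b' : breflect p q b b' -> occ p b' = occ q b.
Proof.
rewrite /breflect; case: leqP => le /(flips_count p); rewrite eqxx (negbTE pq); lia.
Qed.

Lemma breflect_countq b b' : breflect p q b b' -> occ q b' = occ p b.
Proof.
rewrite /breflect; case: leqP => le /(flips_count q); rewrite eqxx qp; lia.
Qed.

Lemma breflect_count a b b' : a != p -> a != q -> breflect p q b b' ->
  occ a b' = occ a b.
Proof.
move=> ap aq; rewrite /breflect; case: leqP => le /(flips_count a);
  rewrite (negbTE ap) (negbTE aq); lia.
Qed.

Lemma breflect_sym b b' : breflect p q b b' -> breflect p q b' b.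
Proof.
move=> R; have Ep := breflect_countp R; have Eq := breflect_countq R.
move: R; rewrite /breflect Ep Eq.
case: (ltngtP (occ q b) (occ p b)) => //.
by move=> -> /=; rewrite subnn.
Qed.

Lemma breflect_size b b' : breflect p q b b' -> size b' = size b.
Proof. by rewrite /breflect; case: leqP => _ /flips_size ->. Qed.

Lemma breflect_all b b' (P : pred nat) : P p -> P q -> breflect p q b b' ->
  all P b' = all P b.
Proof.
move=> Pp Pq; rewrite /breflect; case: leqP => _ f; first exact: flips_all f.
by rewrite (flips_all Pp Pq f).
Qed.

End Reflect.

Notation balS i := (bal i i.+1).
Notation antiS i := (anti i i.+1).

(** Invariance under all crystal operators on words in the letters below [r]: [h] is constant on the
    connected components of the crystal graph. The target is left general so that tests and weights
    are treated alike. *)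
Definition good (T : Type) (r : nat) (h : seq nat -> T) :=
  forall i s t, i.+1 < r -> all (gtn r) s -> all (gtn r) t ->
    antiS i s -> balS i t -> h (s ++ i :: t) = h (s ++ i.+1 :: t).

(** All letters [i] of [a] are matched inside [a], so a flip in the suffix [b] is also a flip of the
    whole word. *)
Lemma good_flips T r (h : seq nat -> T) i a k b b' : good r h -> i.+1 < r ->
  all (gtn r) a -> all (gtn r) b -> antiS i a ->
  flips i i.+1 k b b' -> h (a ++ b) = h (a ++ b').
Proof.
move=> gh ir ra; elim: k b => [|k IH] b rb Aa /=; first by move=> ->.
case=> c [s [t [Eb Ec As Bt]]]; move: rb; rewrite Eb all_cat /=.
case/and3P=> rs _ rt f; rewrite -(IH c) //; last first.
  by rewrite Ec all_cat /= rs rt ir.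
by rewrite Ec !catA gh // ?all_cat ?ra //; apply: anti_cat.
Qed.

Lemma good_breflect T r (h : seq nat -> T) i a b b' : good r h -> i.+1 < r ->
  all (gtn r) a -> all (gtn r) b -> antiS i a ->
  breflect i i.+1 b b' -> h (a ++ b) = h (a ++ b').
Proof.
move=> gh ir ra rb Aa R; move: (R); rewrite /breflect; case: leqP => _ f.
  exact: (good_flips gh ir ra rb Aa f).
apply/esym; apply: (good_flips gh ir ra _ Aa f).
by rewrite (breflect_all _ _ R) //= ltnW.
Qed.

(** * Content sums and ballot sums *)

(** Reindexing along a bijection that is only available as a relation, as is the case for flips and
    reflections. *)
Lemma sum_rel (V : nmodType) (T : eqType) (R : T -> T -> Prop) (s s' : seq T)
    (f f' : T -> V) :
  uniq s -> uniq s' ->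
  (forall x, x \in s -> exists2 y, y \in s' & R x y) ->
  (forall y, y \in s' -> exists2 x, x \in s & R x y) ->
  (forall x y z, R x y -> R x z -> y = z) ->
  (forall x y z, R x z -> R y z -> x = y) ->
  (forall x y, x \in s -> y \in s' -> R x y -> f x = f' y) ->
  (\sum_(x <- s) f x = \sum_(y <- s') f' y)%R.
Proof.
move=> us us' tot sur fn inj eqf; elim: s s' us us' tot sur eqf => [|x s IH] s'.
  case: s' => [|y s'] _ _ _ sur _; first by rewrite !big_nil.
  by case: (sur y (mem_head _ _)).
move=> /= /andP[xs us] us' tot sur eqf.
have [y ys Rxy] := tot x (mem_head _ _).
rewrite big_cons (perm_big _ (perm_to_rem ys)) big_cons (eqf x y) ?mem_head //.
congr (_ + _)%R; apply: IH; rewrite ?rem_uniq //.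
- move=> z zs; have [|w ws Rzw] := tot z; first by rewrite inE zs orbT.
  exists w => //; rewrite mem_rem_uniq // inE ws andbT.
  by apply: contraNneq xs => wy; rewrite (inj x z y) // -wy.
- move=> w; rewrite mem_rem_uniq // inE => /andP[wy ws].
  have [z] := sur w ws; rewrite inE => /predU1P[->|zs] Rzw; last by exists z.
  by case/eqP: wy; apply: fn Rzw Rxy.
move=> z w zs ws; apply: eqf; first by rewrite inE zs orbT.
exact: mem_rem ws.
Qed.

Fixpoint words r n : seq (seq nat) :=
  if n is m.+1 then [seq x :: w | x <- iota 0 r, w <- words r m] else [:: [::]].

Lemma mem_words (r n : nat) (v : seq nat) : (v \in words r n) = (size v == n) && all (gtn r) v.
Proof.
elim: n v => [|n IH] [|x v] //=.
  by apply/negbTE/allpairsP => -[] [? ?] [].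
rewrite eqSS; apply/allpairsP/idP => [[[y w] /= []]|].
  rewrite mem_iota IH => /andP[_ yr] /andP[sw rw] [-> ->].
  by rewrite sw yr rw.
by case/and3P=> sv xr rv; exists (x, v); rewrite mem_iota IH sv xr rv.
Qed.

Lemma words_uniq r n : uniq (words r n).
Proof.
elim: n => //= n IH; apply: allpairs_uniq => //; first exact: iota_uniq.
by move=> [x v] [y w] _ _ /= [-> ->].
Qed.

Definition cont r v := [seq occ i v | i <- iota 0 r].

Lemma size_cont r v : size (cont r v) = r.
Proof. by rewrite size_map size_iota. Qed.

Lemma nth_cont r v i : i < r -> nth 0 (cont r v) i = occ i v.
Proof. by move=> ir; rewrite (nth_map 0) ?size_iota // nth_iota. Qed.

Lemma contP r v a : size a = r -> (forall i, i < r -> occ i v = nth 0 a i) ->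
  cont r v = a.
Proof.
move=> sa E; apply: (@eq_from_nth _ 0); rewrite ?size_cont ?sa // => i ir.
by rewrite nth_cont ?E.
Qed.

Lemma sumn_cont r v : all (gtn r) v -> sumn (cont r v) = size v.
Proof.
elim: v => [|x v IH] /=.
  by move=> _; rewrite /cont sumnE big_map big1.
move=> /andP[xr /IH <-]; rewrite /cont !sumnE !big_map.
under eq_bigr do rewrite occ_cons.
rewrite big_split /= -add1n; congr (_ + _).
rewrite (bigD1_seq x) ?mem_iota ?iota_uniq //= eqxx big1 // => i /negbTE.
by rewrite eq_sym => ->.
Qed.

Section Span.
Local Open Scope ring_scope.
Variables (r n : nat).
Implicit Type h : seq nat -> int.

Definition cont_sum h (a : seq nat) : int := \sum_(v <- words r n | cont r v == a) h v.

Lemma cont_sum_eq0 h a : size a != r -> cont_sum h a = 0.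
Proof.
move=> sa; apply: big1_seq => v /andP[/eqP E _].
by case/eqP: sa; rewrite -E size_cont.
Qed.

(** The reflection in the letters [i] and [i.+1] is a bijection between the words of the two
    contents, and [h] is invariant under it. *)
Lemma cont_sum_swap h a1 x y a2 : good r h ->
  cont_sum h (a1 ++ x :: y :: a2) = cont_sum h (a1 ++ y :: x :: a2).
Proof.
move=> gh; have [sa|sa] := eqVneq (size (a1 ++ x :: y :: a2)) r; last first.
  by rewrite !cont_sum_eq0 //; move: sa; rewrite !size_cat.
set i := size a1.
have ir : (i.+1 < r)%N by rewrite -sa size_cat /= -/i; lia.
have ii : i != i.+1 by lia.
have cR v v' u w : breflect i i.+1 v v' -> cont r v = a1 ++ u :: w :: a2 ->
    cont r v' = a1 ++ w :: u :: a2.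
  move=> R E; apply: contP => [|j jr]; first by rewrite -sa !size_cat.
  have E1 k : (k < r)%N -> occ k v = nth 0%N (a1 ++ u :: w :: a2) k.
    by move=> kr; rewrite -E nth_cont.
  have [->|ji] := eqVneq j i.
    rewrite (breflect_countp ii R) E1 // !nth_cat -/i ltnn ltnNge leqnSn subnn.
    by rewrite subSnn.
  have [->|jSi] := eqVneq j i.+1.
    rewrite (breflect_countq ii R) E1 1?ltnW // !nth_cat -/i ltnn ltnNge leqnSn.
    by rewrite subnn subSnn.
  rewrite (breflect_count ii ji jSi R) E1 // !nth_cat -/i; case: ltnP => // ij.
  case E2: (j - i)%N => [|[|d]] //; lia.
rewrite /cont_sum -big_filter -[RHS]big_filter; apply: (sum_rel (R := breflect i i.+1)).
- exact/filter_uniq/words_uniq.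
- exact/filter_uniq/words_uniq.
- move=> v; rewrite mem_filter mem_words => /andP[/eqP E /andP[sv rv]].
  have [v' R] := breflect_total ii v; exists v' => //.
  rewrite mem_filter mem_words (cR _ _ _ _ R E) eqxx (breflect_size R) sv.
  by rewrite (breflect_all _ _ R) //= ltnW.
- move=> v; rewrite mem_filter mem_words => /andP[/eqP E /andP[sv rv]].
  have [v' R] := breflect_total ii v; exists v'; last exact: breflect_sym.
  rewrite mem_filter mem_words (cR _ _ _ _ R E) eqxx (breflect_size R) sv.
  by rewrite (breflect_all _ _ R) //= ltnW.
- by move=> v v1 v2; apply: breflect_fun.
- by move=> v1 v2 v /(breflect_sym ii) R1 /(breflect_sym ii); apply: breflect_fun R1.
move=> v v'; rewrite mem_filter mem_words => /and3P[_ _ rv] _ R.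
exact: (good_breflect (a := [::]) gh ir isT rv (anti_nil _ _) R).
Qed.

Lemma cont_sum_perm h a b : good r h -> perm_eq a b -> cont_sum h a = cont_sum h b.
Proof.
move=> gh ab.
have mv s1 x s2 s3 : cont_sum h (s1 ++ s2 ++ x :: s3) = cont_sum h (s1 ++ x :: s2 ++ s3).
  elim: s2 s1 => [|y s2 IH] s1 //=.
  by rewrite -cat_rcons IH cat_rcons cont_sum_swap.
have cat s1 s2 s3 : cont_sum h (s1 ++ s2 ++ s3) = cont_sum h (s2 ++ s1 ++ s3).
  elim: s2 s1 => [|x s2 IH] s1 //=.
  by have := mv [::] x s1 (s2 ++ s3); have := IH (x :: s1); have := mv [::] x s2 (s1 ++ s3);
     rewrite /= => -> -> ->.
pose P s := cont_sum h a = cont_sum h s.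
apply: (catCA_perm_ind (P := P)) ab _ => // s1 s2 s3.
by rewrite /P => ->; rewrite cat.
Qed.

(** * Ballot words and the reflection of non-ballot words *)

Definition dominant v := all (fun i => occ i.+1 v <= occ i v)%N (iota 0 r.-1).

Definition ballot v := all (fun j => dominant (take j v)) (iota 0 (size v).+1).

Lemma dominantP v : reflect (forall i, (i.+1 < r)%N -> (occ i.+1 v <= occ i v)%N)
  (dominant v).
Proof.
apply: (iffP allP) => D i; last by rewrite mem_iota => /andP[_ ir]; apply: D; lia.
by move=> ir; apply: D; rewrite mem_iota; lia.
Qed.

Lemma ballotP v : reflect (forall i, (i.+1 < r)%N -> balS i v) (ballot v).
Proof.
apply: (iffP allP) => [B i ir u w E|B j].
  have := B (size u); rewrite E take_size_cat // mem_iota size_cat => D.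
  by apply: (dominantP _ (D _)) => //; lia.
move=> _; apply/dominantP => i ir; apply: (B i ir _ (drop j v)).
by rewrite cat_take_drop.
Qed.

Lemma ballot_rcons v x : ballot (rcons v x) = ballot v && dominant (rcons v x).
Proof.
rewrite /ballot size_rcons -[(size v).+2]addn1 iotaD all_cat all_seq1 add0n.
rewrite [take _.+1 _]take_oversize ?size_rcons //; congr (_ && _).
apply: eq_in_all => j; rewrite mem_iota => jv.
by rewrite -cats1 takel_cat //; lia.
Qed.

(** The split is at the first letter that breaks the ballot condition: it is some [i.+1], read when
    [i] and [i.+1] are tied. *)
Lemma ballotN v : ~~ ballot v -> exists a i b,
  [/\ v = a ++ i.+1 :: b, ballot a, (i.+1 < r)%N & occ i a = occ i.+1 a].
Proof.
elim/last_ind: v => [|v x IH]; first by move/ballotP; case=> i _; exact: bal_nil.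
rewrite ballot_rcons negb_and; case: (boolP (ballot v)) => [B /= D|/IH]; last first.
  by case=> a [i [b [-> Ba ir E]]] _; exists a, i, (rcons b x); rewrite rcons_cat.
have /allPn[i] := D; rewrite mem_iota add0n -ltnNge !occ_rcons => ir lt.
have ir' : (i.+1 < r)%N by lia.
have le := ballotP _ B i ir' v [::] (esym (cats0 v)).
have xi : x = i.+1 by apply/eqP; move: lt; case: (x == i.+1) => //; lia.
exists v, i, [::]; rewrite cats1 -xi; split=> //; rewrite xi in lt le *; first lia.
by move: lt; rewrite eqxx; case: (_ == i) => /=; lia.
Qed.

Lemma nballot a i b : (i.+1 < r)%N -> occ i a = occ i.+1 a ->
  ~~ ballot (a ++ i.+1 :: b).
Proof.
move=> ir E; apply/ballotP => /(_ i ir (rcons a i.+1) b).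
rewrite cat_rcons !occ_rcons eqxx => /(_ erefl).
by rewrite E (_ : (i.+1 == i) = false); lia.
Qed.

Lemma nballot_inj a i b a' i' b' :
  ballot a -> (i.+1 < r)%N -> occ i a = occ i.+1 a ->
  ballot a' -> (i'.+1 < r)%N -> occ i' a' = occ i'.+1 a' ->
  a ++ i.+1 :: b = a' ++ i'.+1 :: b' -> [/\ a = a', i = i' & b = b'].
Proof.
move=> Ba ir E Ba' ir' E' Eab.
case: (cat_cons_cmp Eab) => [[-> [->] ->]//|[u Eu _]|[u Eu _]].
  by move: Ba'; rewrite Eu (negbTE (nballot _ ir E)).
by move: Ba; rewrite Eu (negbTE (nballot _ ir' E')).
Qed.

Definition ballot_sum h (a : seq nat) : int :=
  \sum_(v <- words r n | ballot v && (cont r v == a)) h v.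

(* Adds the staircase r-1, ..., 1, 0, so that partitions become strictly
   decreasing. *)
Fixpoint stair (a : seq nat) : seq nat :=
  if a is x :: a1 then (x + size a1)%N :: stair a1 else [::].

Fixpoint asc (g : seq nat) : nat :=
  if g is x :: g1 then (count (ltn x) g1 + asc g1)%N else 0.

(** The Jacobi-Trudi coefficient: for a partition [nu], the sign of the permutation that carries
    [nu] plus the staircase to [a] plus the staircase. As [stair nu] is then strictly decreasing,
    [asc] counts inversions. *)
Definition jt_sign nu (a : seq nat) : int :=
  if perm_eq (stair a) (stair nu) then (-1) ^+ asc (stair a) else 0.

Lemma stair_inj a b : size a = size b -> stair a = stair b -> a = b.
Proof.
elim: a b => [|x a IH] [|y b] //= [sab] []; rewrite sab => /addIn ->.
by move/IH->.
Qed.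

(** The dot action of an adjacent transposition: exchanging two neighbours after the staircase is
    added sends the entries x, y+1 to y, x+1. *)
Lemma stair_swap a1 x y a2 : exists g1, [/\ size g1 = size a1,
  stair (a1 ++ x :: y.+1 :: a2) = g1 ++ (x + (size a2).+1)%N :: (y + (size a2).+1)%N :: stair a2
  & stair (a1 ++ y :: x.+1 :: a2) = g1 ++ (y + (size a2).+1)%N :: (x + (size a2).+1)%N :: stair a2].
Proof.
elim: a1 => [|z a1 [g1 [sg E1 E2]]]; first by exists [::]; rewrite /= !addSnnS.
exists ((z + size (a1 ++ x :: y.+1 :: a2))%N :: g1); rewrite /= sg E1 E2.
by split=> //; rewrite !size_cat.
Qed.

Lemma sorted_stair a : sorted geq a = sorted gtn (stair a).
Proof.
elim: a => //= x [|y a] //= ->; congr (_ && _); lia.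
Qed.

Lemma asc_swap g1 x y g2 : (x < y)%N ->
  asc (g1 ++ x :: y :: g2) = (asc (g1 ++ y :: x :: g2)).+1.
Proof.
move=> xy; elim: g1 => [|z g1 IH] /=; last first.
  by rewrite IH addnS !count_cat /=; congr (_ + _).+1; lia.
by rewrite xy ltnNge (ltnW xy) /=; lia.
Qed.

Lemma asc_sorted g : sorted gtn g -> asc g = 0%N.
Proof.
elim: g => //= x g IH sg; rewrite IH ?(path_sorted sg) // addn0.
apply/eqP; rewrite -leqn0 leqNgt -has_count; apply/hasPn => y yg /=.
have tr : transitive gtn by move=> u v w /= h1 h2; apply: ltn_trans h2 h1.
by have /allP/(_ y yg) /= := order_path_min tr sg; lia.
Qed.

Lemma gtn_sorted_eq g1 g2 : sorted gtn g1 -> sorted gtn g2 -> perm_eq g1 g2 -> g1 = g2.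
Proof.
move=> s1 s2 /perm_mem; apply: irr_sorted_eq s1 s2 => [x y z h1 h2|x] /=.
  exact: ltn_trans h2 h1.
exact: ltnn.
Qed.

Lemma jt_sign_swap nu a1 x y a2 : sorted geq nu ->
  jt_sign nu (a1 ++ x :: y.+1 :: a2) = - jt_sign nu (a1 ++ y :: x.+1 :: a2).
Proof.
move=> snu; have [g1 [_ E1 E2]] := stair_swap a1 x y a2.
rewrite /jt_sign E1 E2; set X := (x + _)%N; set Z := (y + _)%N.
have pe : perm_eq (g1 ++ X :: Z :: stair a2) (g1 ++ Z :: X :: stair a2).
  rewrite perm_cat2l; apply/seq.permP => P /=; lia.
rewrite (permPl pe); case: ifP => [pn|_]; last by rewrite oppr0.
(* Distinctness, inherited from the strictly decreasing [stair nu], excludes the tie [X = Z], where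
   the swap would not change the sign. *)
have: uniq (g1 ++ Z :: X :: stair a2).
  rewrite (perm_uniq pn); move: snu; rewrite sorted_stair.
  by apply: sorted_uniq => [u v w h1 h2|u] /=; [exact: ltn_trans h2 h1|exact: ltnn].
rewrite cat_uniq /= inE => /and4P[_ _ /norP[/eqP ZX _] _].
case: (ltngtP X Z) => [lt|lt|/esym //].
  by rewrite (asc_swap _ _ lt) exprS mulN1r.
by rewrite (asc_swap _ _ lt) exprS mulN1r opprK.
Qed.

(** A dot orbit contains at most one partition, because a strictly decreasing sequence is determined
    by its entries. *)
Lemma jt_sign_sorted nu a : size a = size nu -> sorted geq nu -> sorted geq a ->
  jt_sign nu a = (a == nu)%:R.
Proof.
move=> sz snu sa; rewrite /jt_sign; case: ifP => [pe|].
  have /stair_inj -> : stair a = stair nu.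
    by apply: gtn_sorted_eq; rewrite -?sorted_stair.
    by rewrite asc_sorted -?sorted_stair // eqxx.
  by [].
by have [->|//] := eqVneq a nu; rewrite perm_refl.
Qed.

Lemma ballot_sorted v : ballot v -> sorted geq (cont r v).
Proof.
move=> B; apply/(sortedP 0%N) => i; rewrite size_cont => ir.
rewrite !nth_cont ?(ltnW ir) //; apply: (ballotP _ B i ir v [::]).
by rewrite cats0.
Qed.

Definition conts := undup [seq cont r v | v <- words r n].

Lemma sum_cont h (w : seq nat -> int) :
  \sum_(v <- words r n) w (cont r v) * h v = \sum_(a <- conts) w a * cont_sum h a.
Proof.
under [RHS]eq_bigr do rewrite /cont_sum big_mkcond mulr_sumr.
rewrite exchange_big /=; apply: eq_big_seq => v vw.
rewrite (bigD1_seq (cont r v)) ?undup_uniq ?mem_undup ?map_f //= eqxx big1 ?addr0 //.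
by move=> a /negbTE; rewrite eq_sym => ->; rewrite mulr0.
Qed.

(** Only the part after the first violation is reflected. The violation stays in place, so this is
    an involution of the non-ballot words. *)
Definition tail_reflect (v v' : seq nat) := exists a i b b',
  [/\ v = a ++ i.+1 :: b, v' = a ++ i.+1 :: b', ballot a, (i.+1 < r)%N
    & occ i a = occ i.+1 a /\ breflect i i.+1 b b'].

Lemma tail_reflect_fun v v1 v2 : tail_reflect v v1 -> tail_reflect v v2 -> v1 = v2.
Proof.
move=> [a [i [b [b1 [-> -> Ba ir [E R]]]]]] [a' [i' [b' [b2 [E' -> Ba' ir' [E'' R']]]]]].
have [ea ei eb] := nballot_inj Ba ir E Ba' ir' E'' E'; rewrite ea ei; congr (_ ++ _ :: _).
by apply: breflect_fun R _; rewrite ?ei ?eb //; lia.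
Qed.

Lemma tail_reflect_sym v v' : tail_reflect v v' -> tail_reflect v' v.
Proof.
move=> [a [i [b [b' [-> -> Ba ir [E R]]]]]]; exists a, i, b', b; split=> //.
by split=> //; apply: breflect_sym R; lia.
Qed.

Lemma tail_reflect_total v : ~~ ballot v -> exists v', tail_reflect v v'.
Proof.
case/ballotN => a [i [b [-> Ba ir E]]].
have [|b' R] := @breflect_total i i.+1 _ b; first lia.
by exists (a ++ i.+1 :: b'), a, i, b, b'.
Qed.

Lemma tail_reflect_nballot v v' : tail_reflect v v' -> ~~ ballot v'.
Proof. by move=> [a [i [b [b' [_ -> _ ir [E _]]]]]]; apply: nballot. Qed.

Lemma tail_reflect_words v v' : tail_reflect v v' -> v \in words r n -> v' \in words r n.
Proof.
move=> [a [i [b [b' [-> -> _ ir [_ R]]]]]]; rewrite !mem_words !all_cat !size_cat /=.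
by rewrite (breflect_size R) (breflect_all _ _ R) //= ltnW.
Qed.

Lemma tail_reflect_good h v v' : good r h -> v \in words r n -> tail_reflect v v' ->
  h v = h v'.
Proof.
move=> gh; rewrite mem_words => /andP[_ rv] [a [i [b [b' [Ev -> Ba ir [E R]]]]]].
move: rv; rewrite Ev all_cat /= => /and3P[ra rSi rb].
(* The prefix up to the violation is [anti]: [a] is ballot with [i] and [i.+1] tied, hence fully
   matched, and the letter after it is [i.+1]. *)
rewrite -!cat_rcons; apply: (good_breflect gh ir _ rb _ R).
  by rewrite all_rcons ra andbT.
apply: anti_rcons; first by lia.
by apply: bal_balanced; [exact: (ballotP _ Ba)|lia..].
Qed.

(** The prefix [a] has [i] and [i.+1] tied and one more [i.+1] is kept, so exchanging the two counts
    in the tail acts on the total content by the dot action. *)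
Lemma tail_reflect_sign nu v v' : sorted geq nu -> tail_reflect v v' ->
  jt_sign nu (cont r v) = - jt_sign nu (cont r v').
Proof.
move=> snu [a [i [b [b' [Ev Ev' _ ir [E R]]]]]].
have ii : i != i.+1 by lia.
have Si : (i.+1 == i) = false by lia.
pose a1 := take i (cont r v); pose a2 := drop i.+2 (cont r v).
have s1 : size a1 = i by rewrite size_take size_cont (ltnW ir).
have Ec : cont r v = a1 ++ (occ i v) :: (occ i.+1 v) :: a2.
  rewrite -{1}(cat_take_drop i (cont r v)); congr (_ ++ _).
  by rewrite 2?(drop_nth 0%N) ?size_cont ?(ltnW ir) // !nth_cont ?(ltnW ir).
have e1 : occ i.+1 v = (occ i v').+1.
  by rewrite Ev Ev' !occE (breflect_countp ii R) eqxx Si E; lia.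
have e2 : occ i.+1 v' = (occ i v).+1.
  by rewrite Ev Ev' !occE (breflect_countq ii R) eqxx Si E; lia.
have Ec' : cont r v' = a1 ++ (occ i v') :: (occ i.+1 v') :: a2.
  apply: contP => [|j jr].
    by rewrite size_cat /= s1 size_drop size_cont; lia.
  rewrite nth_cat s1; case: ltnP => ij; last first.
    case Ej: (j - i)%N => [|[|d]] /=; first by congr (occ _ _); lia.
      by congr (occ _ _); lia.
    rewrite nth_drop nth_cont; last lia.
    have -> : (i.+2 + d = j)%N by lia.
    have ji : j != i by lia.
    have jSi : j != i.+1 by lia.
    by rewrite Ev Ev' !occE (breflect_count ii ji jSi R).
  rewrite nth_take // nth_cont //.
  have ji : j != i by lia.
  have jSi : j != i.+1 by lia.
  by rewrite Ev Ev' !occE (breflect_count ii ji jSi R).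
by rewrite Ec Ec' e1 e2 jt_sign_swap.
Qed.

(* Gessel-Zeilberger reflection: the non-ballot words cancel in pairs. *)
Lemma jacobi_trudi h nu : good r h -> size nu = r -> sorted geq nu ->
  ballot_sum h nu = \sum_(a <- conts) jt_sign nu a * cont_sum h a.
Proof.
move=> gh snu pnu; rewrite -sum_cont (bigID ballot) /=.
have -> : \sum_(v <- words r n | ~~ ballot v) jt_sign nu (cont r v) * h v = 0.
  set S := LHS.
  have : S = - S.
    rewrite {1}/S -sumrN -big_filter -[RHS]big_filter.
    apply: (sum_rel (R := tail_reflect)).
    - exact/filter_uniq/words_uniq.
    - exact/filter_uniq/words_uniq.
    - move=> v; rewrite mem_filter => /andP[/tail_reflect_total[v' R] vw].
      by exists v' => //; rewrite mem_filter (tail_reflect_nballot R) (tail_reflect_words R).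
    - move=> v; rewrite mem_filter => /andP[/tail_reflect_total[v' R] vw].
      exists v'; last exact: tail_reflect_sym.
      by rewrite mem_filter (tail_reflect_nballot R) (tail_reflect_words R).
    - exact: tail_reflect_fun.
    - by move=> x y z /tail_reflect_sym R1 /tail_reflect_sym; apply: tail_reflect_fun.
    move=> v v'; rewrite mem_filter => /andP[_ vw] _ R.
    by rewrite (tail_reflect_sign pnu R) (tail_reflect_good gh vw R) mulNr.
  lia.
(* The content of a ballot word is a partition, so its coefficient is a Kronecker delta. *)
rewrite addr0 /ballot_sum big_mkcondr /=; apply: eq_bigr => v B.
rewrite jt_sign_sorted ?size_cont ?ballot_sorted //.
by case: eqP; rewrite ?mul1r ?mul0r.
Qed.

(** * Inverting the Jacobi-Trudi expansion *)

Definition sq (a : seq nat) : nat := sumn [seq x ^ 2 | x <- a]%N.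

Lemma sq_le a : (sq a <= sumn a ^ 2)%N.
Proof.
elim: a => //= x a; rewrite /sq /= => IH; rewrite sqrnD; lia.
Qed.

Lemma unsorted_adj (T : Type) (e : rel T) (s : seq T) : ~~ sorted e s ->
  exists s1 x y s2, s = s1 ++ x :: y :: s2 /\ ~~ e x y.
Proof.
elim: s => //= x [|y s] //= IH; rewrite negb_and => /orP[xy|/IH].
  by exists [::], x, y, s.
by case=> s1 [u [w [s2 [-> uw]]]]; exists (x :: s1), u, w, s2.
Qed.

(** Unitriangularity, measured by the sum of squares. At an ascent x, y+1 the dot action gives y,
    x+1 and lowers the sum of squares by 2(y - x); repeating this ends in [nu]. *)
Lemma sq_stair nu a : sorted geq nu -> size a = size nu ->
  perm_eq (stair a) (stair nu) -> a = nu \/ (sq nu < sq a)%N.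
Proof.
move=> pnu; have [k] := ubnP (sq a); elim: k a => // k IH a ak sa pe.
have [pa|/unsorted_adj] := boolP (sorted geq a).
  left; apply: stair_inj => //.
  by apply: gtn_sorted_eq; rewrite -?sorted_stair.
move=> [a1 [x [y [a2 [Ea]]]]]; rewrite -ltnNge /= => xy.
case: y => // y in Ea xy *.
have [g1 [_ E1 E2]] := stair_swap a1 x y a2.
(* Equality would give [stair a] a repeated entry. *)
have {}xy : (x < y)%N.
  rewrite ltn_neqAle -ltnS xy andbT; apply/eqP => exy.
  have: uniq (stair a).
    rewrite (perm_uniq pe); move: pnu; rewrite sorted_stair.
    by apply: sorted_uniq => [u v w h1 h2|u] /=; [exact: ltn_trans h2 h1|exact: ltnn].
  by rewrite Ea E1 exy cat_uniq /= inE eqxx /= !andbF.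
have lt : (sq (a1 ++ y :: x.+1 :: a2) < sq a)%N.
  rewrite Ea /sq !map_cat !sumn_cat /= ltn_add2l !addnA ltn_add2r.
  by rewrite -!mulnn; nia.
right; have [||| <-//|] := IH (a1 ++ y :: x.+1 :: a2).
- exact: leq_trans lt _.
- by rewrite -sa Ea !size_cat.
- apply: perm_trans pe; rewrite Ea E1 E2 perm_cat2l; apply/seq.permP => P /=; lia.
by move/ltn_trans; apply.
Qed.

(** The coefficients are chosen before [h]. This uniformity allows one expansion to serve for
    appended and for prepended columns. *)
Definition spans (Q : pred (seq nat)) (B : (seq nat -> int) -> seq nat -> int)
    (F : (seq nat -> int) -> int) :=
  exists2 c : seq (int * seq nat), all (fun x => Q x.2) c
    & forall h, good r h -> F h = \sum_(x <- c) x.1 * B h x.2.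

Lemma spans0 Q B : spans Q B (fun _ => 0).
Proof. by exists [::] => // h _; rewrite big_nil. Qed.

Lemma spansD Q B F G : spans Q B F -> spans Q B G -> spans Q B (fun h => F h + G h).
Proof.
move=> [c Qc E] [d Qd E']; exists (c ++ d); first by rewrite all_cat Qc.
by move=> h gh; rewrite E // E' // big_cat.
Qed.

Lemma spansZ Q B F a : spans Q B F -> spans Q B (fun h => a * F h).
Proof.
move=> [c Qc E]; exists [seq (a * x.1, x.2) | x <- c]; first by rewrite all_map.
by move=> h gh; rewrite E // big_map mulr_sumr; apply: eq_bigr => x _; rewrite mulrA.
Qed.

Lemma spans_eq Q B F G : (forall h, good r h -> F h = G h) ->
  spans Q B F -> spans Q B G.
Proof. by move=> FG [c Qc E]; exists c => // h gh; rewrite -FG ?E. Qed.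

Lemma spans_sum Q B (I : eqType) (s : seq I) (F : I -> (seq nat -> int) -> int) :
  (forall i, i \in s -> spans Q B (F i)) ->
  spans Q B (fun h => \sum_(i <- s) F i h).
Proof.
elim: s => [|i s IH] sF.
  by apply: spans_eq (spans0 Q B) => h _; rewrite big_nil.
apply: spans_eq (spansD (sF i (mem_head _ _)) (IH _)) => [h _|j js].
  by rewrite big_cons.
by apply: sF; rewrite inE js orbT.
Qed.

Lemma spans_base (Q : pred (seq nat)) B a : Q a -> spans Q B (fun h => B h a).
Proof.
by move=> Qa; exists [:: (1, a)] => [|h _]; rewrite /= ?Qa // big_seq1 mul1r.
Qed.

Lemma conts_size a : a \in conts -> size a = r /\ sumn a = n.
Proof.
rewrite mem_undup => /mapP[v]; rewrite mem_words => /andP[/eqP sv rv] ->.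
by rewrite size_cont sumn_cont.
Qed.

Definition parts a := (size a == r) && sorted geq a.

(** By symmetry [a] may be sorted. All other terms of the Jacobi-Trudi expansion at the sorted
    content have a larger sum of squares, which is at most [n ^ 2] on contents that occur, so the
    recursion ends. *)
Lemma cont_sum_span_ballot a : spans parts ballot_sum (fun h => cont_sum h a).
Proof.
have [k] := ubnP (n ^ 2 - sq a); elim: k a => // k IH a ak.
pose b := sort geq a.
have ab : perm_eq a b by rewrite perm_sym perm_sort.
have sqab : sq a = sq b by rewrite /sq; apply/perm_sumn/perm_map.
have pb : sorted geq b by apply: sort_sorted => x y /=; exact: leq_total.
apply: (@spans_eq _ _ (fun h => cont_sum h b)) => [h gh|]; first by rewrite (cont_sum_perm gh ab).
have [bc|bc] := boolP (b \in conts); last first.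
  apply: spans_eq (spans0 _ _) => h _; rewrite /cont_sum big1_seq // => v /andP[/eqP E vw].
  by rewrite mem_undup -E map_f in bc.
have [sb nb] := conts_size bc.
apply: (@spans_eq _ _ (fun h => ballot_sum h b + -1 *
  \sum_(a' <- [seq a' <- conts | a' != b]) jt_sign b a' * cont_sum h a')) => [h gh|].
  rewrite jacobi_trudi // (bigD1_seq b) ?undup_uniq //= big_filter.
  by rewrite jt_sign_sorted // eqxx mul1r mulN1r addrK.
apply: spansD; first by apply: (@spans_base _ ballot_sum); rewrite /parts sb eqxx.
apply: spansZ; apply: spans_sum => a'; rewrite mem_filter => /andP[a'b a'c].
have [sa' na'] := conts_size a'c.
have [pe|pe] := boolP (perm_eq (stair a') (stair b)); last first.
  by apply: spans_eq (spans0 _ _) => h _; rewrite /jt_sign (negbTE pe) mul0r.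
apply/spansZ/IH.
have [/eqP|lt] := sq_stair pb (etrans sa' (esym sb)) pe; first by rewrite (negbTE a'b).
by have := sq_le a'; rewrite na'; lia.
Qed.

Lemma ballot_sum_span_cont a : parts a -> spans predT cont_sum (fun h => ballot_sum h a).
Proof.
move=> /andP[/eqP sa pa].
apply: spans_eq (fun h gh => esym (jacobi_trudi gh sa pa)) _.
by apply: spans_sum => b _; apply/spansZ/(@spans_base _ cont_sum).
Qed.

End Span.

(** * Chains and construction steps *)

Lemma subseq_catr_split (T : eqType) (c s t : seq T) : subseq c (s ++ t) ->
  exists c1 c2, [/\ c = c1 ++ c2, subseq c1 s & subseq c2 t].
Proof.
elim: s c => [|x s IH] c; first by exists [::], c.
case: c => [|y c]; first by exists [::], [::]; rewrite !sub0seq.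
rewrite cat_cons /=; case: eqP => [->|_] /IH [c1 [c2 [E s1 s2]]].
  by exists (x :: c1), c2; rewrite E /= eqxx.
by exists c1, c2; rewrite E; split=> //; apply: subseq_trans (subseq_cons _ _).
Qed.

Lemma subseq_cons_split (T : eqType) (x : T) c t : subseq (x :: c) t ->
  exists t1 t2, t = t1 ++ x :: t2 /\ subseq c t2.
Proof.
elim: t => //= y t IH; case: eqP => [->|_]; first by exists [::], t.
by case/IH => t1 [t2 [-> s2]]; exists (y :: t1), t2.
Qed.

Lemma subseq_rcons_split (T : eqType) (x : T) c t : subseq (rcons c x) t ->
  exists t1 t2, t = t1 ++ x :: t2 /\ subseq c t1.
Proof.
rewrite -subseq_rev rev_rcons => /subseq_cons_split[t1 [t2 [E s2]]].
exists (rev t2), (rev t1); rewrite -[t]revK E rev_cat rev_cons cat_rcons.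
by split=> //; rewrite -[c]revK subseq_rev.
Qed.

Lemma occ_gt0 x s : (0 < occ x s) = (x \in s).
Proof. by rewrite /occ -has_count has_pred1. Qed.

Definition chain (e : rel nat) k (v : seq nat) :=
  [exists m : (size v).-tuple bool, sorted e (mask m v) && (size (mask m v) == k)].

Lemma chainP e k v :
  reflect (exists s, [/\ subseq s v, sorted e s & size s = k]) (chain e k v).
Proof.
apply: (iffP existsP) => [[m /andP[s1 /eqP s2]]|[s [/subseqP[m sm ->] s1 s2]]].
  by exists (mask m v); rewrite mask_subseq.
by exists (Tuple (introT eqP sm)); rewrite s1 s2 eqxx.
Qed.

(* A chain through the flipped letter can be rerouted through the bracket that
   matches its neighbour. *)
Lemma chain_good r k : good r (chain ltn k).
Proof.
move=> i s t ir rs rt As Bt; apply/chainP/chainP => -[c [sub srt sz]].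
- have [c1 [c2 [Ec s1 s2]]] := subseq_catr_split sub.
  have thru : subseq c2 t -> exists s0, [/\ subseq s0 (s ++ i.+1 :: t), sorted ltn s0 & size s0 = k].
    move=> s2t; exists c; rewrite Ec in srt sz *; split=> //.
    by apply: cat_subseq => //; apply: subseq_trans (subseq_cons _ _).
  case: c2 => [|y c3] in Ec s2 thru *; first by apply: thru; apply: sub0seq.
  move: s2 => /=; case: eqP => [Ey|_]; last exact: thru.
  move=> s3; have {thru} : c3 = [::] \/ exists y' c4, c3 = y' :: c4.
    by case: (c3) => [|y' c4]; [left|right; exists y', c4].
  rewrite Ec Ey in srt sz => c3E.
  have [J3|J3] := boolP (i.+1 \in c3).
    case: c3E => [E|[y' [c4 E]]]; first by rewrite E in J3.
    have yJ : y' = i.+1.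
      move: srt J3; rewrite E (sorted_pairwise ltn_trans) pairwise_cat /= => /and3P[_ _].
      move=> /andP[/andP[iy _] /andP[/allP ylt _]].
      rewrite inE => /orP[/eqP//|/ylt /= ]; move: iy => /=; lia.
    rewrite E yJ in s3 srt sz.
    have [t1 [t2 [Et s4]]] := subseq_cons_split s3.
    have it1 : i \in t1.
      have := Bt (rcons t1 i.+1) t2; rewrite cat_rcons => /(_ Et).
      rewrite !occ_rcons eqxx (_ : (i.+1 == i) = false) -?occ_gt0; lia.
    exists (c1 ++ i :: i.+1 :: c4); split=> //.
    apply: cat_subseq => //; apply: subseq_trans (subseq_cons _ _).
    rewrite Et; apply: (@cat_subseq _ [:: i] (i.+1 :: c4)); first by rewrite sub1seq.
    by rewrite /= eqxx.
  exists (c1 ++ i.+1 :: c3); split; last by rewrite -sz !size_cat.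
    by apply: cat_subseq => //=; rewrite eqxx.
  move: srt; rewrite !(sorted_pairwise ltn_trans) !pairwise_cat !allrel_consr /=.
  move=> /and3P[/andP[/allP a1 ->] -> /andP[/allP a3 ->]]; rewrite !andbT.
  apply/andP; split; apply/allP => z zc /=; first by have /= := a1 z zc; lia.
  by have /= := a3 z zc; have : z != i.+1 by [apply: contraNneq J3 => <-]; lia.
have [c1 [c2 [Ec s1 s2]]] := subseq_catr_split sub.
have thru : subseq c2 t -> exists s0, [/\ subseq s0 (s ++ i :: t), sorted ltn s0 & size s0 = k].
  move=> s2t; exists c; rewrite Ec in srt sz *; split=> //.
  by apply: cat_subseq => //; apply: subseq_trans (subseq_cons _ _).
case: c2 => [|y c3] in Ec s2 thru *; first by apply: thru; apply: sub0seq.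
move: s2 => /=; case: eqP => [Ey|_]; last exact: thru.
move=> s3 {thru}; rewrite Ec Ey in srt sz.
have [i1|i1] := boolP (i \in c1).
  have [c0 E] : exists c0, c1 = rcons c0 i.
    case/lastP: c1 => [|c0 z] // in i1 srt {Ec s1 sz} *.
    exists c0; congr rcons; move: srt i1.
    rewrite cat_rcons (sorted_pairwise ltn_trans) pairwise_cat /= allrel_consr.
    move=> /and3P[/andP[/allP a0 _] _ /andP[/andP[zi _] _]].
    by rewrite mem_rcons inE => /orP[/eqP//|/a0 /=]; move: zi => /=; lia.
  rewrite E cat_rcons in s1 srt sz.
  have [s4 [s5 [Es s6]]] := subseq_rcons_split s1.
  have Js5 : i.+1 \in s5.
    have := As s4 (i :: s5) Es.
    rewrite !occ_cons eqxx (_ : (i == i.+1) = false) -?occ_gt0; lia.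
  exists (c0 ++ i :: i.+1 :: c3); split=> //.
  rewrite Es -catA; apply: cat_subseq => //; rewrite /= eqxx.
  apply: (@cat_subseq _ [:: i.+1]); first by rewrite sub1seq.
  exact: subseq_trans (subseq_cons _ _).
exists (c1 ++ i :: c3); split; last by rewrite -sz !size_cat.
  by apply: cat_subseq => //=; rewrite eqxx.
move: srt; rewrite !(sorted_pairwise ltn_trans) !pairwise_cat !allrel_consr /=.
move=> /and3P[/andP[/allP a1 ->] -> /andP[/allP a3 ->]]; rewrite !andbT.
apply/andP; split; apply/allP => z zc /=; last by have /= := a3 z zc; lia.
by have /= := a1 z zc; have : z != i by [apply: contraNneq i1 => <-]; lia.
Qed.

Lemma ballot_mem r v k : ballot r v -> all (gtn r) v -> k.+1 \in v -> k \in v.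
Proof.
move=> B rv kv; have kr := allP rv _ kv.
have := ballotP _ _ B k kr v [::] (esym (cats0 v)).
by rewrite -!occ_gt0 in kv *; lia.
Qed.

Lemma ballot_catl r v w : ballot r (v ++ w) -> ballot r v.
Proof.
move=> /ballotP B; apply/ballotP => i ir; apply: bal_catl (B i ir).
Qed.

(** The last letter of a strictly increasing chain of k+1 letters is at least k, and a ballot word
    contains all letters below any of its letters. Conversely, the first occurrences of 0, ..., k in
    a ballot word come in this order. *)
Lemma chain_ballot r v k : ballot r v -> all (gtn r) v ->
  chain ltn k.+1 v = (k \in v).
Proof.
move=> B rv; apply/chainP/idP => [[s [sub srt sz]]|].
  have down m : m \in v -> forall j, j <= m -> j \in v.
    elim: m => [|m IH] mv j; first by rewrite leqn0 => /eqP->.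
    by rewrite leq_eqVlt => /orP[/eqP->//|]; rewrite ltnS; apply/IH/(ballot_mem B).
  have ge j : j < size s -> j <= nth 0 s j.
    elim: j => // j IH js; apply: leq_ltn_trans (IH (ltnW js)) _.
    by have /(sortedP 0)/(_ j js) := srt.
  apply: (down (nth 0 s k)); last by apply: ge; rewrite sz.
  by apply: (mem_subseq sub); rewrite mem_nth // sz.
move=> kv; exists (iota 0 k.+1); rewrite size_iota iota_ltn_sorted; split=> //.
elim: k v B rv kv => [|k IH] v B rv kv; first by rewrite sub1seq.
have [a [b [Ev ka]]] : exists a b, v = a ++ k.+1 :: b /\ k.+1 \notin a.
  exists (take (index k.+1 v) v), (drop (index k.+1 v).+1 v).
  rewrite -{1}(cat_take_drop (index k.+1 v) v) (drop_nth 0) ?index_mem // nth_index //.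
  by split=> //; apply: contraTN isT => /index_ltn; rewrite ltnn.
have [a' [Ea Ba ra]] : exists a', [/\ a' = rcons a k.+1, ballot r a' & all (gtn r) a'].
  exists (rcons a k.+1); split=> //; first by apply: (@ballot_catl _ _ b); rewrite cat_rcons -Ev.
  by move: rv; rewrite Ev -cat_rcons all_cat => /andP[].
have ka' : k \in a.
  have : k \in a' by apply: ballot_mem Ba ra _; rewrite Ea mem_rcons inE eqxx.
  by rewrite Ea mem_rcons inE (_ : (k == k.+1) = false) //; lia.
have Baa : ballot r a by apply: (@ballot_catl _ _ [:: k.+1]); rewrite cats1 -Ea.
have raa : all (gtn r) a by move: ra; rewrite Ea all_rcons => /andP[].
rewrite Ev -[k.+2]addn1 iotaD; apply: cat_subseq; first exact: IH.
by rewrite /= add0n eqxx sub0seq.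
Qed.

Lemma nth_cont_all r v k : all (gtn r) v -> nth 0 (cont r v) k = occ k v.
Proof.
move=> rv; have [kr|rk] := ltnP k r; first exact: nth_cont.
rewrite nth_default ?size_cont //; apply/esym/eqP; rewrite -leqn0 leqNgt occ_gt0.
by apply/negP => /(allP rv) /=; lia.
Qed.

Local Open Scope ring_scope.

Lemma good_mul r (g : seq nat -> bool) (h : seq nat -> int) :
  good r g -> good r h -> good r (fun v => (g v)%:R * h v).
Proof. by move=> gg gh i s t ir rs rt As Bt; rewrite gg // gh. Qed.

Lemma good_avoid r k : good r (fun v => ~~ chain ltn k v).
Proof. by move=> i s t ir rs rt As Bt; rewrite (chain_good k ir). Qed.

(** In terms of ballot sums the avoidance test depends on the content alone, so it multiplies each
    coefficient by 0 or 1; afterwards ballot sums are expanded back into content sums. *)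
Lemma cont_sum_avoid_span r n k a : (0 < k)%N ->
  spans r predT (cont_sum r n)
    (fun h => cont_sum r n (fun v => (~~ chain ltn k v)%:R * h v) a).
Proof.
case: k => // k _; have [c Qc E] := cont_sum_span_ballot r n a.
apply: (@spans_eq _ _ _ (fun h =>
  \sum_(x <- c) (x.1 * (~~ (0 < nth 0%N x.2 k)%N)%:R) * ballot_sum r n h x.2)) => [h gh|].
  rewrite E; last exact: (good_mul (@good_avoid _ _)).
  apply: eq_big_seq => x xc; rewrite -mulrA; congr (_ * _).
  rewrite /ballot_sum mulr_sumr big_seq_cond [RHS]big_seq_cond.
  apply: eq_bigr => v; rewrite mem_words => /and3P[/andP[_ rv] B /eqP <-].
  by rewrite (chain_ballot _ B) // nth_cont_all // occ_gt0.
apply: spans_sum => x xc; apply/spansZ/ballot_sum_span_cont.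
exact: (allP Qc).
Qed.

(** * Filling counts and the adjoints of their construction steps *)

Definition ncol (o : seq (option nat)) := count isSome o.

Lemma ncol_some p o : ncol (Some p :: o) = (ncol o).+1. Proof. by []. Qed.
Lemma ncol_none o : ncol (None :: o) = ncol o. Proof. by []. Qed.
Lemma ncol_cat o1 o2 : ncol (o1 ++ o2) = (ncol o1 + ncol o2)%N.
Proof. exact: count_cat. Qed.
Lemma ncol_run ps : ncol (map Some ps) = size ps.
Proof. by rewrite /ncol count_map count_predT. Qed.

(* The steps are listed latest first: [Some p] adds a column with p ones, and
   [None] deletes the bottom row after testing P on the word of columns of the
   remaining ones.  [fills P o v] counts the ways to arrive at v. *)
Fixpoint fills (P : pred (seq nat)) (o : seq (option nat)) (v : seq nat) : nat :=
  match o with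
  | [::] => v == [::]
  | Some p :: o1 =>
      ((occ (ncol o1) v == p) * fills P o1 [seq x <- v | x < ncol o1])%N
  | None :: o1 =>
      \sum_(x <- iota 0 (ncol o1)) (P (rcons v x) * fills P o1 (rcons v x))%N
  end.

(** Under this pairing each construction step on [f] has an adjoint that acts on the test function
    [h] and preserves goodness. *)
Definition pair r n (h : seq nat -> int) (f : seq nat -> nat) : int :=
  \sum_(v <- words r n) h v * (f v)%:R.

Definition rv r (v : seq nat) := [seq (r.-1 - x)%N | x <- v].

Lemma rv_words r n v : v \in words r n -> rv r v \in words r n.
Proof.
rewrite !mem_words size_map => /andP[-> rv0] /=.
by rewrite all_map; apply: sub_all rv0 => x /=; lia.
Qed.

Lemma rvK r v : all (gtn r) v -> rv r (rv r v) = v.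
Proof.
move=> rv0; rewrite /rv -map_comp -[RHS]map_id; apply/eq_in_map => x /(allP rv0) /=.
lia.
Qed.

Lemma pair_rv r n h f :
  pair r n (h \o rv r) f = pair r n h (f \o rv r).
Proof.
rewrite /pair; apply: (sum_rel (R := fun v w => all (gtn r) v /\ all (gtn r) w /\ w = rv r v));
  rewrite ?words_uniq //.
- move=> v vw; exists (rv r v); first exact: rv_words.
  by move: (vw) (rv_words vw); rewrite !mem_words => /andP[_ ->] /andP[_ ->].
- move=> v vw; exists (rv r v); first exact: rv_words.
  by move: (vw) (rv_words vw); rewrite !mem_words => /andP[_ rv0] /andP[_ ->]; rewrite rvK.
- by move=> x y z [_ [_ ->]] [_ [_ ->]].
- by move=> x y z [rx [_ ->]] [ry [_ E]]; rewrite -(rvK rx) E rvK.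
by move=> v w _ _ [rv0 [_ ->]] /=; rewrite rvK.
Qed.

Section Extend.
Variables (r z : nat) (em un : nat -> nat).
Hypothesis emS : forall i, em i.+1 = (em i).+1.
Hypothesis em_z : forall i, (i < r)%N -> em i != z.
Hypothesis em_lt : forall i, (i < r)%N -> (em i < r.+1)%N.
Hypothesis un_lt : forall x, (x < r.+1)%N -> x != z -> (un x < r)%N.
Hypothesis unK : forall x, (x < r.+1)%N -> x != z -> em (un x) = x.
Hypothesis emK : forall i, un (em i) = i.

Definition keep (w : seq nat) : seq nat := [seq x <- w | x != z].

(** The adjoint of adding a column: [z] is the new letter and [em] renames the old ones. It is used
    with [z] last for appending and with [z] first for prepending. *)
Definition ext n (h : seq nat -> int) (u : seq nat) : int :=
  \sum_(w <- words r.+1 n | keep w == map em u) h w.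

Let em_inj : injective em. Proof. exact: can_inj emK. Qed.

Lemma keep_un w : all (gtn r.+1) w -> map em (map un (keep w)) = keep w.
Proof.
move=> rw; rewrite -map_comp -[RHS]map_id; apply/eq_in_map => x.
by rewrite mem_filter => /andP[xz /(allP rw)] /= xr; rewrite unK.
Qed.

Lemma size_keep w : (size (keep w) + occ z w)%N = size w.
Proof. by rewrite size_filter addnC -(count_predC (pred1 z)). Qed.

Lemma un_words n p w : w \in words r.+1 n -> (p <= n)%N ->
  (map un (keep w) \in words r (n - p)) = (occ z w == p).
Proof.
rewrite !mem_words size_map => /andP[/eqP sw rw] pn.
have -> : all (gtn r) (map un (keep w)).
  apply/allP => y /mapP[x]; rewrite mem_filter => /andP[xz xw] ->.
  exact (un_lt (allP rw x xw) xz).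
by rewrite andbT; have := size_keep w; rewrite sw; lia.
Qed.

Lemma ext_adj n p h (f : seq nat -> nat) :
  \sum_(w <- words r.+1 n) h w * ((occ z w == p) * f (map un (keep w)))%N%:R
  = if (p <= n)%N then pair r (n - p) (ext n h) f else 0.
Proof.
case: leqP => [pn|np]; last first.
  apply: big1_seq => w; rewrite mem_words => /= /andP[/eqP sw _].
  have := size_keep w; case: eqP => [|_]; first by rewrite sw; lia.
  by rewrite mulr0.
rewrite /pair /ext.
under [RHS]eq_bigr do rewrite big_mkcond mulr_suml.
rewrite exchange_big /=; apply: eq_big_seq => w ww.
have rw : all (gtn r.+1) w by move: ww; rewrite mem_words => /andP[].
have [e|ne] := boolP (occ z w == p).
  rewrite (bigD1_seq (map un (keep w))) ?words_uniq ?un_words //= keep_un // eqxx mul1n.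
  rewrite big1 ?addr0 // => u une; case: eqP => [E|]; last by rewrite mul0r.
  case/eqP: une; rewrite E -map_comp -[LHS]map_id; apply/eq_map => x.
  by rewrite /= emK.
rewrite mul0n mulr0 big1_seq // => u /= uw; case: eqP => [E|]; last by rewrite mul0r.
case/negP: ne; rewrite -(un_words ww pn) E -map_comp (eq_map (g := id)) ?map_id //.
Qed.

Lemma cont_sum_ext n p h b b' : (p <= n)%N ->
  (forall w, all (gtn r.+1) w ->
     (cont r.+1 w == b') = (occ z w == p) && (cont r (map un (keep w)) == b)) ->
  cont_sum r (n - p) (ext n h) b = cont_sum r.+1 n h b'.
Proof.
move=> pn Eb; have := ext_adj n p h (fun u => cont r u == b : nat).
rewrite pn => E; transitivity (pair r (n - p) (ext n h) (fun u => cont r u == b)).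
  rewrite /cont_sum /pair big_mkcond; apply: eq_bigr => v _.
  by case: eqP; rewrite ?mulr1 ?mulr0.
rewrite -E /cont_sum [RHS]big_mkcond; apply: eq_big_seq => w.
rewrite mem_words => /andP[_ /Eb ->]; rewrite mulnb.
by case: (_ && _); rewrite ?mulr1 ?mulr0.
Qed.

Lemma keep_split w l1 x l2 : keep w = l1 ++ x :: l2 ->
  exists w1 w2, [/\ w = w1 ++ x :: w2, keep w1 = l1 & keep w2 = l2].
Proof.
elim: w l1 => [|y w IH] l1 /=; first by case: l1.
case: ifP => yz.
  case: l1 => [|y' l1] [<- E]; first by exists [::], w.
  have [w1 [w2 [-> <- <-]]] := IH _ E; exists (y :: w1), w2; split=> //=.
  by rewrite /keep /= yz.
by case/IH => w1 [w2 [-> <- <-]]; exists (y :: w1), w2; rewrite /keep /= yz.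
Qed.

Lemma occ_em i w u : (i < r)%N -> keep w = map em u -> occ (em i) w = occ i u.
Proof.
move=> ir E; transitivity (occ (em i) (keep w)).
  rewrite /occ /keep count_filter; apply: eq_count => x /=.
  by case: eqP => // ->; rewrite em_z.
by rewrite E /occ count_map; apply: eq_count => x /=; rewrite (inj_eq em_inj).
Qed.

Lemma map_cat_split (u : seq nat) (l1 l2 : seq nat) : map em u = l1 ++ l2 ->
  exists u1 u2, [/\ u = u1 ++ u2, l1 = map em u1 & l2 = map em u2].
Proof.
move=> E; exists (take (size l1) u), (drop (size l1) u).
by rewrite cat_take_drop map_take map_drop E take_size_cat // drop_size_cat.
Qed.

(** [em] keeps neighbouring letters neighbouring and avoids [z]. So the inserted letters [z] are no
    brackets, and the same insertion can be made before and after a flip. *)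
Lemma ext_good n h : good r.+1 h -> good r (ext n h).
Proof.
move=> gh i s t ir rs rt As Bt; rewrite /ext -big_filter -[RHS]big_filter.
pose R w w' := exists ws wt, [/\ w = ws ++ em i :: wt, w' = ws ++ (em i).+1 :: wt,
  keep ws = map em s & keep wt = map em t].
have zi : em i != z by apply: em_z; lia.
have zSi : (em i).+1 != z by rewrite -emS; apply: em_z.
have rSi : ((em i).+1 < r.+1)%N by rewrite -emS; apply: em_lt.
have ri : (em i < r.+1)%N by lia.
have uniqd (ws wt ws' wt' : seq nat) x y : x != z -> y != z ->
    ws ++ x :: wt = ws' ++ y :: wt' -> keep ws = keep ws' -> ws = ws' /\ wt = wt'.
  move=> xz yz Ew; case: (cat_cons_cmp Ew) => [[-> _ ->]//|[u -> _]|[u -> _]] /(congr1 size);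
    rewrite /keep filter_cat size_cat /= ?xz ?yz /=; lia.
apply: (sum_rel (R := R)).
- exact/filter_uniq/words_uniq.
- exact/filter_uniq/words_uniq.
- move=> w; rewrite mem_filter mem_words map_cat => /andP[/eqP E /andP[sw rw]].
  have [ws [wt [Ew Es Et]]] := keep_split E.
  exists (ws ++ (em i).+1 :: wt); last by exists ws, wt.
  rewrite mem_filter mem_words /keep filter_cat /= zSi -/(keep ws) -/(keep wt) Es Et.
  rewrite map_cat /= emS eqxx; move: sw rw.
  by rewrite Ew !size_cat !all_cat /= => -> /and3P[-> _ ->] /=; rewrite andbT.
- move=> w; rewrite mem_filter mem_words map_cat /= emS => /andP[/eqP E /andP[sw rw]].
  have [ws [wt [Ew Es Et]]] := keep_split E.
  exists (ws ++ em i :: wt); last by exists ws, wt.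
  rewrite mem_filter mem_words /keep filter_cat /= zi -/(keep ws) -/(keep wt) Es Et.
  rewrite map_cat /= eqxx; move: sw rw.
  by rewrite Ew !size_cat !all_cat /= => -> /and3P[-> _ ->] /=; rewrite andbT.
- move=> w w1 w2 [ws [wt [-> -> Es Et]]] [ws' [wt' [E -> Es' Et']]].
  by have [|-> ->] := uniqd _ _ _ _ _ _ zi zi E; first by rewrite Es.
- move=> w1 w2 w [ws [wt [-> -> Es Et]]] [ws' [wt' [-> E Es' Et']]].
  by have [|-> ->] := uniqd _ _ _ _ _ _ zSi zSi E; first by rewrite Es.
move=> w w'; rewrite mem_filter mem_words => /and3P[_ _ rw] _ [ws [wt [Ew -> Es Et]]].
move: rw; rewrite Ew all_cat /= => /and3P[rws _ rwt].
apply: gh => // u v E.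
  move: Es; rewrite E /keep filter_cat => /esym/map_cat_split[s1 [s2 [Es E1 E2]]].
  rewrite -emS (occ_em ir E2) (occ_em (ltnW ir) E2); exact: As Es.
move: Et; rewrite E /keep filter_cat => /esym/map_cat_split[s1 [s2 [Et E1 E2]]].
rewrite -emS (occ_em ir E1) (occ_em (ltnW ir) E1); exact: Bt Et.
Qed.

End Extend.

Section Append.
Variable r : nat.

Definition extA := ext r r id.
Definition extB := ext r 0%N succn.

Lemma extA_good n h : good r.+1 h -> good r (extA n h).
Proof. by apply: (ext_good (un := id)) => // i; lia. Qed.

Lemma extB_good n h : good r.+1 h -> good r (extB n h).
Proof. by apply: (ext_good (un := predn)) => // i; lia. Qed.

Lemma keep_lt w : all (gtn r.+1) w -> [seq x <- w | (x < r)%N] = keep r w.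
Proof.
move=> rw; apply: eq_in_filter => x /(allP rw) /=; lia.
Qed.

Lemma keep_rv w : all (gtn r.+1) w ->
  [seq x <- rv r.+1 w | (x < r)%N] = rv r (map predn (keep 0 w)).
Proof.
elim: w => //= x w IH /andP[xr /IH E]; rewrite E.
case: x xr => [|x] xr /=; first by rewrite subn0 ltnn.
have -> : (r - x.+1 < r)%N by lia.
by congr (_ :: _); lia.
Qed.

Lemma occ_rv w : all (gtn r.+1) w -> occ r (rv r.+1 w) = occ 0 w.
Proof.
elim: w => //= x w IH /andP[xr /IH]; rewrite !occ_cons => ->; congr (_ + _)%N; lia.
Qed.

Lemma cont_sum_extA n p h b : (p <= n)%N ->
  cont_sum r (n - p) (extA n h) b = cont_sum r.+1 n h (rcons b p).
Proof.
move=> pn; apply: (cont_sum_ext (un := id)) => //; try by move=> *; lia.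
move=> w rw; rewrite map_id.
have -> : cont r.+1 w = rcons (cont r (keep r w)) (occ r w).
  rewrite /cont -addn1 iotaD map_cat cats1; congr rcons.
  apply/eq_in_map => i; rewrite mem_iota => ir.
  apply: (occ_em (r := r) (z := r) (em := id) (un := id)) => //; first by move=> *; lia.
  by rewrite map_id.
by rewrite eqseq_rcons andbC.
Qed.

Lemma cont_sum_extB n p h b : (p <= n)%N ->
  cont_sum r (n - p) (extB n h) b = cont_sum r.+1 n h (p :: b).
Proof.
move=> pn; apply: (cont_sum_ext (un := predn)) => //; try by move=> *; lia.
move=> w rw; have -> : cont r.+1 w = occ 0 w :: cont r (map predn (keep 0 w)).
  rewrite /cont /= -[1%N]/(1 + 0)%N iotaDl -map_comp; congr (_ :: _).
  apply/eq_in_map => i; rewrite mem_iota => ir /=.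
  apply: (occ_em (r := r) (z := 0%N) (em := succn) (un := predn)) => //.
  rewrite -map_comp -[LHS]map_id; apply/eq_in_map => x; rewrite mem_filter /=; lia.
by rewrite eqseq_cons.
Qed.

End Append.

Lemma pair_up P r n h p o : ncol o = r ->
  pair r.+1 n h (fills P (Some p :: o)) =
  if (p <= n)%N then pair r (n - p) (extA r n h) (fills P o) else 0.
Proof.
move=> nr; rewrite -(@ext_adj r r id id) //; try by move=> *; lia.
apply: eq_big_seq => w; rewrite mem_words => /andP[_ rw].
by rewrite /= nr keep_lt // map_id.
Qed.

(** After reversing the columns, the newly added column is the letter 0 and all others move up by
    one. *)
Lemma pair_up_rv P r n h p o : ncol o = r ->
  pair r.+1 n h (fills P (Some p :: o) \o rv r.+1) =
  if (p <= n)%N then pair r (n - p) (extB r n h) (fills P o \o rv r) else 0.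
Proof.
move=> nr; rewrite -(@ext_adj r 0%N succn predn) //; try by move=> *; lia.
apply: eq_big_seq => w; rewrite mem_words => /andP[_ rw].
by rewrite /= nr keep_rv // occ_rv.
Qed.

Definition chop (w : seq nat) := take (size w).-1 w.

Lemma chop_rcons v x : chop (rcons v x) = v.
Proof. by rewrite /chop size_rcons -cats1 take_size_cat. Qed.

(** Either the flipped letter itself is removed, or the suffix after it loses its last letter, and
    [bal] is inherited by prefixes. *)
Lemma chop_good (T : Type) r (h : seq nat -> T) : good r h -> good r (h \o chop).
Proof.
move=> gh i s t ir rs rt As Bt /=; case/lastP: t rt Bt => [|t x] rt Bt.
  by rewrite !cats1 !chop_rcons.
rewrite -!rcons_cons -!rcons_cat !chop_rcons; apply: gh => //.
  by move: rt; rewrite all_rcons => /andP[].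
by apply: (@bal_catl _ _ _ [:: x]); rewrite cats1.
Qed.

Lemma chop_rv r w : chop (rv r w) = rv r (chop w).
Proof. by rewrite /chop size_map -map_take. Qed.

Lemma words_rcons r n :
  perm_eq (words r n.+1) [seq rcons v x | v <- words r n, x <- iota 0 r].
Proof.
apply: uniq_perm; first exact: words_uniq.
  apply: allpairs_uniq; [exact: words_uniq|exact: iota_uniq|].
  by move=> [v x] [w y] _ _ /= /rcons_inj[-> ->].
move=> w; rewrite mem_words; apply/andP/allpairsP => [[]|[[v x] /= [vw xr ->]]].
  case/lastP: w => // w x; rewrite size_rcons eqSS all_rcons => sw /andP[xr rw].
  by exists (w, x); rewrite /= mem_words mem_iota sw.
move: vw xr; rewrite mem_words mem_iota all_rcons size_rcons eqSS => /andP[-> ->].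
by rewrite andbT.
Qed.

Lemma pair_down P r n h o : ncol o = r ->
  pair r n h (fills P (None :: o)) =
  pair r n.+1 (fun w => (P w)%:R * h (chop w)) (fills P o).
Proof.
move=> nr; rewrite /pair (perm_big _ (words_rcons r n)) big_allpairs_dep /=.
apply: eq_bigr => v _; rewrite nr natr_sum mulr_sumr; apply: eq_bigr => x _.
by rewrite chop_rcons natrM mulrCA mulrA.
Qed.

Lemma eq_pair r n h h' f : (forall v, v \in words r n -> h v = h' v) ->
  pair r n h f = pair r n h' f.
Proof. by move=> E; apply: eq_big_seq => v vw; rewrite E. Qed.

Lemma pair_down_rv P r n h o : ncol o = r ->
  pair r n h (fills P (None :: o) \o rv r) =
  pair r n.+1 (fun w => (P (rv r w))%:R * h (chop w)) (fills P o \o rv r).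
Proof.
move=> nr; rewrite -!pair_rv pair_down //; apply: eq_pair => v.
by rewrite mem_words => /andP[_ rv0] /=; rewrite chop_rv rvK.
Qed.

Lemma chain_map (e e' : rel nat) (f : nat -> nat) k (v : seq nat) :
  {in v &, forall x y, e (f x) (f y) = e' x y} -> chain e k (map f v) = chain e' k v.
Proof.
move=> ef; have E s : subseq s v -> sorted e (map f s) = sorted e' s.
  move=> sv; rewrite sorted_map; apply: (@eq_in_sorted _ (mem v)) => //.
  by apply/allP; apply: mem_subseq.
apply/chainP/chainP => -[s [sub srt sz]].
  case/subseqP: sub => m sm Es; exists (mask m v); rewrite mask_subseq.
  by rewrite -E ?mask_subseq // map_mask -Es srt -sz Es -map_mask size_map.
by exists (map f s); rewrite map_subseq // E // size_map.
Qed.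

Lemma chain_rv r k v : all (gtn r) v -> chain gtn k (rv r v) = chain ltn k v.
Proof.
move=> rv0; apply: chain_map => x y /(allP rv0) /= xr /(allP rv0) /= yr.
by apply/idP/idP; lia.
Qed.

Definition av e k v := ~~ chain e k v.

Lemma cont_sum_chop_span r n a : spans r predT (cont_sum r n) (fun h => cont_sum r n.+1 (h \o chop) a).
Proof.
pose dec i := [seq (nth 0%N a j - (j == i))%N | j <- iota 0 r].
(* Sum over the removed letter [i]. The first guard discards [i] absent from [a], where truncated
   subtraction would return [a] itself; the second one discards sequences of the wrong length, which
   [dec] would repair. *)
apply: (@spans_eq _ _ _ (fun h =>
   \sum_(i <- iota 0 r) (0 < nth 0%N a i)%N%:R * ((size a == r)%:R * cont_sum r n h (dec i)))) => [h _|].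
  have [sa|sa] := eqVneq (size a) r; last first.
    rewrite cont_sum_eq0 // big1 // => i _; by rewrite mul0r mulr0.
  rewrite {2}/cont_sum (big_mkcond (fun v => cont r v == a)).
  rewrite (perm_big _ (words_rcons r n)) big_allpairs_dep /=.
  under eq_bigr do rewrite mul1r /cont_sum mulr_sumr big_mkcond.
  rewrite exchange_big /=; apply: eq_big_seq => v vw; apply: eq_big_seq => i.
  rewrite mem_iota => ir; rewrite chop_rcons.
  have -> : (cont r (rcons v i) == a) = (0 < nth 0%N a i)%N && (cont r v == dec i).
    apply/eqP/andP => [E|[a0 /eqP E]].
      have na j : (j < r)%N -> nth 0%N a j = (occ j v + (i == j))%N.
        by move=> jr; rewrite -E nth_cont // occ_rcons.
      rewrite na // eqxx addn1; split=> //; apply/eqP/contP.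
        by rewrite size_map size_iota.
      move=> j jr; rewrite (nth_map 0%N) ?size_iota // nth_iota // na //.
      by rewrite (eq_sym i) addnK.
    apply: contP => // j jr; have := congr1 (nth 0%N ^~ j) E.
    rewrite /dec (nth_map 0%N) ?size_iota // nth_iota // nth_cont // occ_rcons (eq_sym i) => ->.
    by rewrite add0n; have [->|_] := eqVneq j i; rewrite ?subn0 ?addn0 // subnK.
  by case: (0 < _)%N => /=; rewrite ?mul1r ?mul0r //; case: ifP.
by apply: spans_sum => i _; do 2!apply: spansZ; apply: (@spans_base _ _ (cont_sum r n)).
Qed.

(** One list of coefficients serves both countings, by induction on the steps. A new column puts its
    sum at the end or at the front of the content, which symmetry makes equal; a deleted row acts
    through the universal expansions of avoidance and of chopping. *)
Lemma fills_span k o n : (0 < k)%N -> exists c : seq (int * seq nat),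
  forall h, good (ncol o) h ->
    pair (ncol o) n h (fills (av ltn k) o) = \sum_(x <- c) x.1 * cont_sum (ncol o) n h x.2 /\
    pair (ncol o) n h (fills (av gtn k) o \o rv (ncol o)) =
      \sum_(x <- c) x.1 * cont_sum (ncol o) n h x.2.
Proof.
move=> k0; elim: o n => [|[p|] o IH] n.
- case: n => [|n].
    exists [:: (1, [::])] => h _; rewrite /pair /cont_sum !big_seq1 /=.
    by rewrite mulr1 mul1r.
  by exists [::] => h _; rewrite /pair /= !big_nil.
- have [c E] := IH (n - p)%N; have [pn|np] := leqP p n; last first.
    exists [::] => h; rewrite ncol_some big_nil => gh.
    by rewrite pair_up // pair_up_rv // leqNgt np.
  exists [seq (x.1, rcons x.2 p) | x <- c] => h; rewrite ncol_some => gh.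
  rewrite big_map /= pair_up // pair_up_rv // pn.
  rewrite (proj1 (E _ (extA_good n gh))) (proj2 (E _ (extB_good n gh))).
  split; apply: eq_bigr => x _; first by rewrite cont_sum_extA.
  by rewrite cont_sum_extB //; congr (_ * _); apply: cont_sum_perm gh _; rewrite perm_sym perm_rcons.
have [c E] := IH n.+1.
have [d _ E'] : spans (ncol o) predT (cont_sum (ncol o) n) (fun h => \sum_(x <- c) x.1 *
    cont_sum (ncol o) n.+1 (fun w => (av ltn k w)%:R * h (chop w)) x.2).
  apply: spans_sum => x _; apply: spansZ.
  have [d _ E'] := cont_sum_avoid_span (ncol o) n.+1 x.2 k0.
  apply: (@spans_eq _ _ _ (fun h => \sum_(y <- d) y.1 * cont_sum (ncol o) n.+1 (h \o chop) y.2)).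
    by move=> h gh; rewrite -E' //; apply: chop_good.
  by apply: spans_sum => y _; apply/spansZ/cont_sum_chop_span.
exists d => h; rewrite ncol_none => gh; rewrite -E' //.
rewrite pair_down // pair_down_rv //.
have gh' : good (ncol o) (fun w => (av ltn k w)%:R * h (chop w)).
  by apply: good_mul; [apply: good_avoid|apply: (chop_good gh)].
rewrite (proj1 (E _ gh')) -(proj2 (E _ gh')); split=> //; apply: eq_pair => v.
by rewrite mem_words => /andP[_ rv0]; rewrite /av chain_rv.
Qed.

Lemma pair_nil r h f : pair r 0 h f = h [::] * (f [::])%:R.
Proof. by rewrite /pair big_seq1. Qed.

Lemma good1 r : good r (fun _ => 1 : int). Proof. by []. Qed.

Theorem fills_ltn_gtn k o : (0 < k)%N ->
  fills (av ltn k) o [::] = fills (av gtn k) o [::].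
Proof.
move=> k0; have [c E] := fills_span o 0 k0.
have [E1 E2] := E _ (@good1 _); move: E2; rewrite -E1 !pair_nil !mul1r /=.
by move/eqP; rewrite Num.Theory.eqr_nat => /eqP ->.
Qed.

(** The coefficients do not depend on [ps]: a final run of column additions only extends the
    contents, where symmetry allows the entries of [ps] to be permuted. *)
Lemma fills_run k o m : (0 < k)%N -> exists c : seq (int * seq nat),
  forall ps h, good (size ps + ncol o)%N h ->
  pair (size ps + ncol o)%N (m + sumn ps) h (fills (av ltn k) (map Some ps ++ o)) =
  \sum_(x <- c) x.1 * cont_sum (size ps + ncol o)%N (m + sumn ps) h (x.2 ++ rev ps).
Proof.
move=> k0; have [c E] := fills_span o m k0; exists c => ps.
elim: ps => [|p ps IH] h gh /=.
  rewrite addn0 (proj1 (E _ gh)); apply: eq_bigr => x _.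
  by rewrite cats0.
have nE : ncol (map Some ps ++ o) = (size ps + ncol o)%N by rewrite ncol_cat ncol_run.
rewrite addSn pair_up // (_ : p <= m + (p + sumn ps))%N; last by lia.
have En : (m + (p + sumn ps) - p)%N = (m + sumn ps)%N by lia.
rewrite En IH; last exact: extA_good.
apply: eq_bigr => x _; rewrite -En cont_sum_extA; last by lia.
by rewrite rev_cons rcons_cat.
Qed.

Lemma fills_run0 P o ps n h : (n < sumn ps)%N ->
  pair (size ps + ncol o)%N n h (fills P (map Some ps ++ o)) = 0.
Proof.
elim: ps n h => //= p ps IH n h np.
have nE : ncol (map Some ps ++ o) = (size ps + ncol o)%N by rewrite ncol_cat ncol_run.
by rewrite addSn pair_up //; case: leqP => // pn; apply: IH; lia.
Qed.

(** Equality against all good test functions survives any later steps [o], since their adjoints send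
    good functions to good functions. *)
Lemma fills_context k o o1 o2 : ncol o1 = ncol o2 ->
  (forall n h, good (ncol o1) h ->
     pair (ncol o1) n h (fills (av ltn k) o1) = pair (ncol o1) n h (fills (av ltn k) o2)) ->
  forall n h, good (ncol (o ++ o1)) h ->
     pair (ncol (o ++ o1)) n h (fills (av ltn k) (o ++ o1)) =
     pair (ncol (o ++ o1)) n h (fills (av ltn k) (o ++ o2)).
Proof.
move=> n12 E; elim: o => [|[p|] o IH] // n h.
  rewrite cat_cons ncol_some => gh.
  rewrite !pair_up //; last by rewrite !ncol_cat n12.
  by case: ifP => // _; apply/IH/extA_good.
rewrite cat_cons ncol_none => gh.
rewrite !pair_down //; last by rewrite !ncol_cat n12.
by apply: IH; apply: good_mul; [apply: good_avoid|apply: (chop_good gh)].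
Qed.

Theorem fills_perm k o o' ps qs : (0 < k)%N -> perm_eq ps qs ->
  fills (av ltn k) (o ++ map Some ps ++ o') [::] =
  fills (av ltn k) (o ++ map Some qs ++ o') [::].
Proof.
move=> k0 pq.
have nE us : ncol (map Some us ++ o') = (size us + ncol o')%N by rewrite ncol_cat ncol_run.
have := @fills_context k o (map Some ps ++ o') (map Some qs ++ o').
rewrite !nE (perm_size pq) => /(_ erefl) C.
have {C} /(_ 0%N _ (@good1 _)) : forall n h, good (ncol (o ++ map Some ps ++ o')) h ->
   pair (ncol (o ++ map Some ps ++ o')) n h (fills (av ltn k) (o ++ map Some ps ++ o')) =
   pair (ncol (o ++ map Some ps ++ o')) n h (fills (av ltn k) (o ++ map Some qs ++ o')).
  apply: C => n h gh; have sz := perm_size pq; have sm : sumn ps = sumn qs by apply: perm_sumn.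
  have [le|lt] := leqP (sumn qs) n; last first.
    have := @fills_run0 (av ltn k) o' ps n h; rewrite sz sm => -> //.
    by rewrite fills_run0.
  have [c E] := fills_run o' (n - sumn qs) k0.
  have := E ps h; have := E qs h; rewrite sm sz subnK // => -> // -> //.
  apply: eq_bigr => x _; congr (_ * _); apply: cont_sum_perm gh _.
  rewrite perm_cat2l; apply/seq.permP => P; rewrite !count_rev; exact/seq.permP.
by rewrite !pair_nil !mul1r => /eqP; rewrite Num.Theory.eqr_nat => /eqP.
Qed.

Local Close Scope ring_scope.

(** * Merged columns *)

(** Checks one construction history. It is recorded by the word [s] of deleted letters, topmost row
    first, so that [v ++ s] is the complete word. *)
Fixpoint feasible (P : pred (seq nat)) (o : seq (option nat)) (v s : seq nat) : bool :=
  match o with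
  | [::] => (v == [::]) && (s == [::])
  | Some p :: o1 =>
      (occ (ncol o1) v == p) && feasible P o1 [seq x <- v | x < ncol o1] s
  | None :: o1 =>
      if s is x :: s1
      then [&& x < ncol o1, P (rcons v x) & feasible P o1 (rcons v x) s1]
      else false
  end.

(* The numbers of columns at the deletions of rows, topmost row first. *)
Fixpoint row_lens (o : seq (option nat)) : seq nat :=
  match o with
  | [::] => [::]
  | Some _ :: o1 => row_lens o1
  | None :: o1 => ncol o1 :: row_lens o1
  end.

Fixpoint col_sum (o : seq (option nat)) (c : nat) : nat :=
  match o with
  | [::] => 0
  | Some p :: o1 => if c == ncol o1 then p else col_sum o1 c
  | None :: o1 => col_sum o1 c
  end.

(** The alphabet bound [m] is free because the number of columns drops along the induction; surplus
    letters are rejected by [feasible]. *)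
Lemma fills_count P o m v : ncol o <= m ->
  fills P o v = count (feasible P o v) (words m (size (row_lens o))).
Proof.
elim: o v => [|[p|] o IH] v /= le.
- by rewrite andbT addn0.
- rewrite (IH _ (ltnW le)); case: (_ == p); first by rewrite mul1n.
  by rewrite mul0n; apply/esym/eqP; rewrite -leqn0 leqNgt -has_count has_pred0.
have -> : iota 0 m = iota 0 (ncol o) ++ iota (ncol o) (m - ncol o).
  by rewrite -iotaD subnKC.
rewrite count_flatten sumnE !big_map big_cat /=.
rewrite [RHS]addnC [X in _ = X + _]big1_seq ?add0n => [|x /=].
  apply: eq_big_seq => x; rewrite mem_iota /= add0n => xo.
  rewrite count_map (IH _ le); case Px: (P (rcons v x)).
    by rewrite mul1n; apply: eq_count => w /=; rewrite xo Px.
  rewrite mul0n; apply/esym/eqP; rewrite -leqn0 leqNgt -has_count -all_predC.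
  by apply/allP => w _ /=; rewrite Px andbF.
rewrite mem_iota => /andP[xo _]; rewrite count_map; apply/eqP.
rewrite -leqn0 leqNgt -has_count -all_predC.
by apply/allP => w _ /=; rewrite ltnNge xo.
Qed.

Lemma row_lens_le o : all (geq (ncol o)) (row_lens o).
Proof.
elim: o => [|[p|] o IH] //=; rewrite ?leqnn //.
by apply: sub_all IH => x /=; lia.
Qed.

(** Makes the history static: restricting the rows down to row [j] to the columns present when row
    [j] was deleted recovers the word tested at that moment. *)
Lemma feasibleP (P : pred (seq nat)) o v s : all (gtn (ncol o)) v ->
  reflect [/\ size s = size (row_lens o),
     forall j, j < size s -> nth 0 s j < nth 0 (row_lens o) j /\
       P [seq x <- v ++ take j.+1 s | x < nth 0 (row_lens o) j]
   & forall c, c < ncol o -> occ c (v ++ s) = col_sum o c]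
  (feasible P o v s).
Proof.
elim: o v s => [|[p|] o IH] v s rv /=.
- have -> : v = [::] by case: (v) rv.
  apply: (iffP eqP) => [-> //|[sz _ _]]; exact: size0nil.
- have rv' : all (gtn (ncol o)) [seq x <- v | x < ncol o] by apply: filter_all.
  have fE j w : nth 0 (row_lens o) j <= ncol o ->
      [seq x <- [seq x <- v | x < ncol o] ++ w | x < nth 0 (row_lens o) j] =
      [seq x <- v ++ w | x < nth 0 (row_lens o) j].
    move=> le; rewrite !filter_cat -filter_predI; congr (_ ++ _).
    by apply: eq_filter => x /=; lia.
  have le j : nth 0 (row_lens o) j <= ncol o.
    have [js|js] := ltnP j (size (row_lens o)); last by rewrite nth_default.
    exact: (allP (row_lens_le o) _ (mem_nth 0 js)).
  have oE c : c < ncol o -> occ c ([seq x <- v | x < ncol o] ++ s) = occ c (v ++ s).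
    move=> co; rewrite !occ_cat; congr (_ + _); rewrite /occ count_filter.
    by apply: eq_count => x /=; case: eqP => // ->; rewrite co.
  (* Rows deleted before the column was added cannot meet it, so all its ones lie in [v]. *)
  have o0 : (forall j, j < size s -> nth 0 s j < nth 0 (row_lens o) j) -> occ (ncol o) s = 0.
    move=> H; apply/eqP; rewrite -leqn0 leqNgt occ_gt0; apply/negP => /(nthP 0)[j js E].
    by have := H j js; rewrite E; have := le j; lia.
  apply: (iffP andP) => [[/eqP E /IH []// sz Hj Hc]|[sz Hj Hc]].
    split=> // [j js|c]; first by have [? ?] := Hj j js; rewrite -fE.
    rewrite ltnS leq_eqVlt; have [-> _|ne /= co] := eqVneq c (ncol o).
      by rewrite occ_cat E o0 ?addn0 // => j /Hj[].
    by rewrite -oE // Hc.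
  split.
    have := Hc _ (leqnn _); rewrite eqxx occ_cat o0 ?addn0 => [-> //|j js].
    by have [] := Hj j js.
  apply/IH => //; split=> // [j js|c co]; first by have [? ?] := Hj j js; rewrite fE.
  by have := Hc c (ltnW co); rewrite ltn_eqF // oE.
have rvx x : x < ncol o -> all (gtn (ncol o)) (rcons v x) by rewrite all_rcons /= => ->.
have fid x : x < ncol o -> [seq y <- v ++ [:: x] | y < ncol o] = rcons v x.
  by move=> xo; rewrite cats1; apply/all_filterP/rvx.
case: s => [|x s]; first by constructor=> -[].
apply: (iffP and3P) => [[xo Px /(IH _ _ (rvx _ xo)) [sz Hj Hc]]|[[sz] Hj Hc]].
  split=> [|[|j] js|c co]; first by rewrite /= sz.
  - by rewrite /= take0 fid.
  - by have := Hj j js; rewrite cat_rcons.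
  by rewrite -Hc // cat_rcons.
have [xo] := Hj 0 isT; rewrite /= take0 fid // => Px; split=> //.
apply/(IH _ _ (rvx _ xo)); split=> // [j js|c co]; last by rewrite cat_rcons Hc.
by have := Hj j.+1 js; rewrite cat_rcons.
Qed.

Section Merge.
Variables (G : nat -> bool) (d : nat -> nat).

(* Columns m and m+1 are glued when G m holds, and there are d m rows of length
   m+1 in the diagram. *)
Fixpoint steps p m : seq (option nat) :=
  if m is m1.+1 then
    if G m1 then steps p.+1 m1 else Some p :: nseq (d m1) None ++ steps 1 m1
  else [:: Some p].

Definition all_steps m := nseq (d m) None ++ steps 1 m.

Fixpoint rows m : seq nat :=
  if m is m1.+1 then nseq (d m1) m ++ rows m1 else [::].

(** The index of the merged column that contains column [c]. *)
Definition blk c := count (fun i => ~~ G i) (iota 0 c).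

Lemma blkS c : blk c.+1 = blk c + ~~ G c.
Proof. by rewrite /blk -addn1 iotaD count_cat /= addn0. Qed.

Lemma blk_le c c' : c <= c' -> blk c <= blk c'.
Proof. by move=> /subnKC <-; rewrite /blk iotaD count_cat leq_addr. Qed.

Lemma blk_lt c c' : blk c < blk c' -> c < c'.
Proof. by apply: contraLR; rewrite -!leqNgt; apply: blk_le. Qed.

Lemma ncol_down q o : ncol (nseq q None ++ o) = ncol o.
Proof. by elim: q. Qed.

Lemma ncol_steps p m : ncol (steps p m) = (blk m).+1.
Proof.
elim: m p => //= m IH p; rewrite blkS; case: (G m); first by rewrite IH addn0.
by rewrite /= ncol_down IH addn1.
Qed.

Lemma row_lens_down q o : row_lens (nseq q None ++ o) = nseq q (ncol o) ++ row_lens o.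
Proof. by elim: q => //= q ->; rewrite ncol_down. Qed.

Lemma row_lens_steps p m : (forall c, c < m -> G c -> d c = 0) ->
  row_lens (steps p m) = [seq (blk l.-1).+1 | l <- rows m].
Proof.
elim: m p => //= m IH p Gd; have Gd' c : c < m -> G c -> d c = 0.
  by move=> cm; apply: Gd; apply: ltnW.
case: ifP => Gm; first by rewrite Gd // IH.
by rewrite /= row_lens_down IH // ncol_steps map_cat map_nseq.
Qed.

(** The counter [p.+1] includes column [m] itself, so [p] is the number of columns to its right
    already merged with it. *)
Lemma col_sum_steps p m c : c < ncol (steps p.+1 m) ->
  col_sum (steps p.+1 m) c =
  count (fun i => blk i == c) (iota 0 m.+1) + (if c == blk m then p else 0).
Proof.
have dn q o : col_sum (nseq q None ++ o) c = col_sum o c by elim: q.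
elim: m p => [|m IH] p; first by case: c {dn} => // _; rewrite addn0 add1n.
rewrite -[in iota _ _]addn1 iotaD count_cat [count _ (iota (0 + _) _)]/= addn0 add0n.
set X := count _ (iota 0 m.+1); rewrite blkS /=; case: (G m) => /=.
  by rewrite addn0 => /IH ->; rewrite -/X (eq_sym (blk m)); case: eqP => _; lia.
rewrite dn ncol_down ncol_steps addn1; case: eqP => [Ec|ne] co.
  rewrite Ec eqxx (_ : X = 0) ?add0n //.
  apply/eqP; rewrite -leqn0 leqNgt -has_count -all_predC; apply/allP => i.
  rewrite mem_iota => /= im; have : blk i <= blk m by apply: blk_le; lia.
  by rewrite Ec neq_ltn ltnS => ->.
rewrite (_ : (blk m).+1 == c = false) ?addn0; last by apply/eqP => E; rewrite E in ne.
by rewrite IH ?ncol_steps //; [case: ifP; rewrite !addn0|lia].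
Qed.

Lemma rowsP m l : l \in rows m -> [/\ 0 < l, l <= m & 0 < d l.-1].
Proof.
elim: m => //= m IH; rewrite mem_cat mem_nseq => /orP[/andP[dm /eqP->]//|/IH[]].
by move=> -> lm ->; rewrite ltnW.
Qed.

End Merge.

(** * Standardization: splitting merged columns again *)

Lemma subseq2_index (x : seq nat) a b : uniq x ->
  subseq [:: a; b] x = [&& a \in x, b \in x, a != b & index a x < index b x].
Proof.
elim: x => //= y x IH /andP[yx ux]; rewrite !inE !(eq_sym _ y).
case: (eqVneq y a) => [<-|ya] /=.
  rewrite sub1seq; case: (eqVneq y b) => [<-|yb] /=; first exact: negbTE.
  by rewrite andbT.
rewrite IH //; case: (eqVneq y b) => [<-|yb] //=.
by rewrite (negbTE yx) /= !andbF.
Qed.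

Lemma sorted_subseq2 (e e' : rel nat) (s : seq nat) :
  (forall a b, subseq [:: a; b] s -> e a b -> e' a b) -> sorted e s -> sorted e' s.
Proof.
elim: s => // x [|y s] // IH H /= /andP[exy ps].
rewrite (H x y) /= ?eqxx ?sub0seq //; apply: IH => // a b sub; apply: H.
exact: (subseq_trans sub (subseq_cons _ x)).
Qed.

Definition ord_rel (b : bool) : rel nat := if b then ltn else gtn.
(** For [x < y], the order in which two glued columns form no chain for [ord_rel b], just as two
    equal letters of the merged word form none. *)
Definition ord_pair (b : bool) (x y : nat) := if b then [:: y; x] else [:: x; y].

Section Blocks.
Variable f : nat -> nat.

Lemma fiber_ext (x x' : seq nat) : map f x = map f x' ->
  (forall q, [seq c <- x | f c == q] = [seq c <- x' | f c == q]) -> x = x'.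
Proof.
elim: x x' => [|a x IH] [|a' x'] //= [fa fx] E.
have := E (f a); rewrite -fa eqxx => -[ea _]; rewrite -ea; congr cons.
by apply: IH => // q; have := E q; rewrite -fa -ea; case: ifP => // _ [].
Qed.

Lemma fiber_exists (y : seq nat) (L : nat -> seq nat) :
  (forall q, size (L q) = occ q y) -> (forall q, all (fun c => f c == q) (L q)) ->
  exists2 x, map f x = y & forall q, [seq c <- x | f c == q] = L q.
Proof.
elim: y L => [|q0 y IH] L sL fL.
  by exists [::] => // q; have /size0nil -> := sL q.
case EL : (L q0) (sL q0) (fL q0) => [|a L0]; rewrite occ_cons eqxx //= => -[sL0].
case/andP => /eqP fa fL0.
have [||x Ex Ef] := IH (fun q => if q == q0 then L0 else L q).
- by move=> q; case: eqP => [->//|/eqP ne]; rewrite sL occ_cons eq_sym (negbTE ne).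
- by move=> q; case: eqP => [->|].
exists (a :: x) => [|q] /=; first by rewrite fa Ex.
by rewrite Ef fa (eq_sym q0); case: eqP => [->|].
Qed.

End Blocks.

Section Bijection.
Variables (G : nat -> bool) (d : nat -> nat) (m k : nat) (b : bool).
Hypothesis Gd : forall c, c < m -> G c -> d c = 0.

Local Notation n := m.+1.
Local Notation la := (rows d n).
Local Notation f := (blk G).

(* It is enough to test each row against the rectangle above it whose width is
   the length of that row. *)
Definition filling (x : seq nat) :=
  all (fun j => (nth 0 x j < nth 0 la j) &&
     av (ord_rel b) k [seq c <- take j.+1 x | c < nth 0 la j]) (iota 0 (size la))
  && all (fun c => occ c x == 1) (iota 0 n).

Definition glued (x : seq nat) :=
  all (fun c => G c ==> subseq (ord_pair b c c.+1) x) (iota 0 m).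

Lemma fillingP x : reflect
  [/\ forall j, j < size la -> nth 0 x j < nth 0 la j /\
     av (ord_rel b) k [seq c <- take j.+1 x | c < nth 0 la j]
   & forall c, c < n -> occ c x = 1] (filling x).
Proof.
apply: (iffP andP) => -[H1 H2]; split.
- by move=> j jl; apply/andP; apply: (allP H1); rewrite mem_iota.
- by move=> c cn; apply/eqP; apply: (allP H2); rewrite mem_iota.
- by apply/allP => j; rewrite mem_iota => /H1 [-> ->].
by apply/allP => c; rewrite mem_iota => /H2 ->.
Qed.

Lemma gluedP x : reflect (forall c, c < m -> G c -> subseq (ord_pair b c c.+1) x)
  (glued x).
Proof.
apply: (iffP allP) => H c; first by move=> cm; apply/implyP/H; rewrite mem_iota.
by rewrite mem_iota => cm; apply/implyP/H.
Qed.

Lemma perm_filling x : all (gtn n) x -> (forall c, c < n -> occ c x = 1) ->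
  perm_eq x (iota 0 n).
Proof.
move=> rx H; rewrite /perm_eq; apply/allP => c; rewrite mem_cat mem_iota => cn.
have {}cn : c < n by case/orP: cn => // /(allP rx).
apply/eqP; rewrite [RHS]count_uniq_mem ?iota_uniq // mem_iota cn.
exact: H.
Qed.

(** By [Gd] no row ends inside a merged column, so truncating to a row commutes with merging. *)
Lemma blk_row c l : c < n -> l \in la -> (f c < (f l.-1).+1) = (c < l).
Proof.
move=> cn /rowsP[l0 ln dl]; have [cl|lc] := ltnP c l.
  by rewrite ltnS blk_le //; lia.
apply/negbTE; rewrite -leqNgt; apply: leq_trans (blk_le G lc).
rewrite -[in X in _ < X](prednK l0) blkS; case Gl: (G l.-1); last by rewrite addn1.
by move: dl; rewrite Gd //; lia.
Qed.

Section Glued.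
Variable x : seq nat.
Hypotheses (rx : all (gtn n) x) (x1 : forall c, c < n -> occ c x = 1) (gx : glued x).

Let px : perm_eq x (iota 0 n). Proof. exact: perm_filling. Qed.
Let ux : uniq x. Proof. by rewrite (perm_uniq px) iota_uniq. Qed.
Let memx c : (c \in x) = (c < n). Proof. by rewrite (perm_mem px) mem_iota. Qed.

Lemma glued_pair c c' : c < c' -> c' < n -> f c = f c' -> subseq (ord_pair b c c') x.
Proof.
move=> cc' cn fc; have step i : c <= i -> i < c' -> subseq (ord_pair b i i.+1) x.
  move=> ci ic; apply: (gluedP _ gx); first by lia.
  have := @blk_le G _ _ ci; have := @blk_le G _ _ ic; rewrite -fc blkS.
  by case: (G i) => //=; lia.
have : forall i, i.+1 + c <= c' -> subseq (ord_pair b c (i.+1 + c)) x.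
  elim=> [|i IH] ic; first by rewrite add1n; apply: step; lia.
  have := IH (ltnW ic); have := step (i.+1 + c).
  have cl : c < n by lia. have il : i.+1 + c < n by lia. have jl : i.+2 + c < n by lia.
  case: (b); rewrite /= !subseq2_index // !memx cl il jl /= => H1 H2.
    have /andP[_ lt1] := H1 ltac:(lia) ltac:(lia); case/andP: H2 => _ lt2.
    by rewrite -addSn in lt1 *; rewrite (ltn_trans lt1 lt2) andbT; lia.
  have /andP[_ lt1] := H1 ltac:(lia) ltac:(lia); case/andP: H2 => _ lt2.
  by rewrite -addSn in lt1 *; rewrite (ltn_trans lt2 lt1) andbT; lia.
by move/(_ (c' - c.+1)); rewrite (_ : (c' - c.+1).+1 + c = c'); [apply|]; lia.
Qed.

(** The gluing constraints fix the order of the columns inside each block; hence [x] can be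
    recovered from its merged word. *)
Lemma glued_block q : [seq c <- x | f c == q] =
  (if b then rev else id) [seq c <- iota 0 n | f c == q].
Proof.
pose r : rel nat := if b then gtn else ltn.
have rx' : sorted r [seq c <- x | f c == q].
  apply: (@sorted_subseq2 (fun _ _ => true)); last first.
    by case: [seq _ <- _ | _] => // a l /=; elim: l a => //=.
  move=> a c; rewrite subseq_filter /= andbT => /andP[/andP[/eqP fa /eqP fc] sub] _.
  move: (sub); rewrite subseq2_index // !memx => /and4P[an cn ac lt].
  rewrite /r; case Eb: b; rewrite /= ltn_neqAle ?ac 1?eq_sym ?ac //= leqNgt; apply/negP => lt'.
    have := glued_pair lt' cn; rewrite fa fc Eb => /(_ erefl).
    by rewrite /= subseq2_index // ltnNge (ltnW lt) !andbF.
  have := glued_pair lt' an; rewrite fa fc Eb => /(_ erefl).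
  by rewrite /= subseq2_index // ltnNge (ltnW lt) !andbF.
have ri : sorted r ((if b then rev else id) [seq c <- iota 0 n | f c == q]).
  by rewrite /r; case: b; rewrite ?rev_sorted; apply: sorted_filter (iota_ltn_sorted _ _) => ? ? ?;
     [exact: ltn_trans|exact: ltn_trans].
apply: irr_sorted_eq rx' ri _.
- by rewrite /r; case: b => y z t /= h1 h2; [exact: ltn_trans h2 h1|exact: ltn_trans h1 h2].
- by rewrite /r; case: b => y /=; rewrite ltnn.
by move=> c; case: b; rewrite ?mem_rev !mem_filter mem_iota memx.
Qed.

(** [blk] is monotone, and a chain of [x] uses each block at most once because columns of one block
    appear in the opposite order. *)
Lemma glued_chain l j : chain (ord_rel b) k [seq f c | c <- [seq c <- take j x | c < l]] =
  chain (ord_rel b) k [seq c <- take j x | c < l].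
Proof.
set w := [seq _ <- _ | _].
have wx : subseq w x.
  by apply: subseq_trans (filter_subseq _ _) _; apply: take_subseq.
apply/chainP/chainP => -[s [sub srt sz]].
  case/subseqP: sub => mk _ Es; exists (mask mk w); rewrite mask_subseq.
  split=> //; last by rewrite -sz Es -map_mask size_map.
  move: srt; rewrite Es -map_mask sorted_map; apply: sub_sorted => u v /=.
  by rewrite /ord_rel; case: b => /=; apply: blk_lt.
exists [seq f c | c <- s]; rewrite size_map map_subseq //; split=> //.
rewrite sorted_map; apply: sorted_subseq2 srt => u v subs /=.
have := subseq_trans subs (subseq_trans sub wx).
rewrite subseq2_index // !memx => /and4P[un vn uv lt].
rewrite /ord_rel; case Eb: b => /= uv'; rewrite ltn_neqAle blk_le 1?ltnW // andbT; apply/negP => /eqP fE.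
  have := glued_pair uv' vn fE; rewrite Eb /= subseq2_index //.
  by rewrite ltnNge (ltnW lt) !andbF.
have := glued_pair uv' un fE; rewrite Eb /= subseq2_index //.
by rewrite ltnNge (ltnW lt) !andbF.
Qed.

End Glued.
Local Notation o := (all_steps G d m).

Lemma ncol_all_steps : ncol o = (f m).+1.
Proof. by rewrite /all_steps ncol_down ncol_steps. Qed.

Lemma row_lens_all_steps : row_lens o = [seq (f l.-1).+1 | l <- la].
Proof.
by rewrite /all_steps row_lens_down row_lens_steps // ncol_steps map_cat map_nseq.
Qed.

Lemma col_sum_all_steps c : c < (f m).+1 ->
  col_sum o c = count (fun i => f i == c) (iota 0 n).
Proof.
move=> cm; have dn q o' : col_sum (nseq q None ++ o') c = col_sum o' c by elim: q.
by rewrite /all_steps dn col_sum_steps ?ncol_steps //; case: ifP; rewrite addn0.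
Qed.

Lemma blk_filter l j x : all (gtn n) x -> l \in la ->
  [seq c <- take j (map f x) | c < (f l.-1).+1] = map f [seq c <- take j x | c < l].
Proof.
move=> rx lla; rewrite -map_take filter_map; congr map; apply: eq_in_filter => c cx.
by rewrite /= blk_row //; apply: (allP rx); apply: mem_subseq cx; apply: take_subseq.
Qed.

Lemma blk_feasible x : x \in words n (size la) -> filling x -> glued x ->
  feasible (av (ord_rel b) k) o [::] (map f x).
Proof.
rewrite mem_words => /andP[/eqP sx rx] /fillingP[H1 H2] gx.
apply/feasibleP => //; split; first by rewrite row_lens_all_steps !size_map.
- move=> j; rewrite size_map sx cat0s => jl; have [xl avx] := H1 j jl.
  rewrite row_lens_all_steps !(nth_map 0) ?sx // blk_row ?mem_nth //; last first.
    by apply: (allP rx); rewrite mem_nth ?sx.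
  by split=> //; rewrite blk_filter ?mem_nth // /av glued_chain.
move=> c; rewrite ncol_all_steps => cm; rewrite col_sum_all_steps // cat0s /occ count_map.
by rewrite (seq.permP (perm_filling rx H2)).
Qed.

(** The equal letters of [y] are replaced, from left to right, by the columns of their block in the
    order that gluing prescribes. *)
Lemma feasible_blk y : y \in words (f m).+1 (size la) ->
  feasible (av (ord_rel b) k) o [::] y ->
  exists2 x, [/\ x \in words n (size la), filling x & glued x] & map f x = y.
Proof.
rewrite mem_words => /andP[/eqP sy ry] /feasibleP[] // _ H1 H2.
rewrite ncol_all_steps in H2.
pose L q := (if b then rev else id) [seq c <- iota 0 n | f c == q].
have memL c q : (c \in L q) = (c < n) && (f c == q).
  by rewrite /L; case: b; rewrite ?mem_rev mem_filter mem_iota andbC.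
have uL q : uniq (L q) by rewrite /L; case: b; rewrite ?rev_uniq filter_uniq ?iota_uniq.
have [||x Ex fx] := @fiber_exists f y L.
- move=> q; have -> : size (L q) = count (fun c => f c == q) (iota 0 n).
    by rewrite /L; case: b; rewrite ?size_rev size_filter.
  have [qm|mq] := ltnP q (f m).+1; first by rewrite -col_sum_all_steps // -H2.
  have -> : occ q y = 0.
    by apply/eqP; rewrite -leqn0 leqNgt occ_gt0; apply/negP => /(allP ry) /=; lia.
  apply/eqP; rewrite -leqn0 leqNgt -has_count -all_predC; apply/allP => c.
  rewrite mem_iota /= => cn; have : f c <= f m by apply: blk_le; lia.
  by rewrite neq_ltn => /leq_ltn_trans ->.
- by move=> q; apply/allP => c; rewrite memL => /andP[].
have rx : all (gtn n) x.
  apply/allP => c cx; have : c \in L (f c) by rewrite -fx mem_filter eqxx.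
  by rewrite memL => /andP[].
have x1 c : c < n -> occ c x = 1.
  move=> cn; transitivity (occ c (L (f c))).
    by rewrite -fx /occ count_filter; apply: eq_count => z /=; case: eqP => // ->; rewrite eqxx.
  by rewrite /occ count_uniq_mem // memL cn eqxx.
have gx : glued x.
  apply/gluedP => c cm Gc; have sub : subseq [:: c; c.+1] [seq i <- iota 0 n | f i == f c].
    have -> : n = c + (2 + (n - c.+2)) by lia.
    rewrite subseq_filter iotaD [iota (0 + c) _]iotaD; apply/andP; split.
      by rewrite /= blkS Gc addn0 eqxx.
    exact: (subseq_trans (prefix_subseq (iota c 2) _) (suffix_subseq _ _)).
  have : subseq (ord_pair b c c.+1) (L (f c)).
    rewrite /L /ord_pair; case: (b) => //.
    by rewrite -[[:: c.+1; c]]/(rev [:: c; c.+1]) subseq_rev.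
  by rewrite -fx subseq_filter => /andP[].
have sx : size x = size y by rewrite -Ex size_map.
exists x => //; split=> //; first by rewrite mem_words sx sy eqxx.
apply/fillingP; split=> // j jl.
have := H1 j; rewrite cat0s sy row_lens_all_steps (nth_map 0) // -Ex => /(_ jl).
rewrite blk_filter ?mem_nth // /av glued_chain //.
have xn : nth 0 x j < n by apply: (allP rx); rewrite mem_nth ?sx ?sy.
by rewrite (nth_map 0) ?sx ?sy // blk_row ?mem_nth.
Qed.

Theorem fills_filling :
  fills (av (ord_rel b) k) o [::] =
  count (fun x => filling x && glued x) (words n (size la)).
Proof.
rewrite (fills_count _ _ (leqnn _)) ncol_all_steps row_lens_all_steps size_map.
rewrite -!size_filter -[RHS](size_map (map f)); apply/perm_size/uniq_perm.
- exact/filter_uniq/words_uniq.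
- rewrite map_inj_in_uniq ?filter_uniq ?words_uniq // => x x'.
  rewrite !mem_filter !mem_words => /andP[/andP[/fillingP[_ x1] gx] /andP[_ rx]].
  move=> /andP[/andP[/fillingP[_ x1'] gx'] /andP[_ rx']] /fiber_ext; apply=> q.
  by rewrite glued_block // [RHS]glued_block.
move=> y; rewrite mem_filter; apply/andP/mapP => [[fy yw]|[x]].
  have [x [xw fx gx] Ex] := feasible_blk yw fy.
  by exists x => //; rewrite mem_filter fx gx.
rewrite mem_filter => /andP[/andP[fx gx] xw] ->; split; first exact: blk_feasible.
move: xw; rewrite !mem_words size_map => /andP[-> rx]; rewrite all_map.
by apply: sub_all rx => c /= cn; rewrite ltnS blk_le.
Qed.

End Bijection.

(** * Constraints on ascents and descents *)

Fixpoint compo p (B : seq bool) : seq nat :=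
  match B with
  | [::] => [:: p]
  | true :: B1 => compo p.+1 B1
  | false :: B1 => p :: compo 1 B1
  end.

Lemma compo_cat p B1 B2 : compo p (B1 ++ false :: B2) = compo p B1 ++ compo 1 B2.
Proof. by elim: B1 p => [|[] B1 IH] p //=; rewrite IH. Qed.

(** A list of glued gaps only is a palindrome; otherwise it is cut at an unglued gap and the two
    halves are treated by induction. *)
Lemma compo_rev B : perm_eq (compo 1 (rev B)) (compo 1 B).
Proof.
have [q] := ubnP (size B); elim: q B => // q IH B Bq.
have [Bf|Bt] := boolP (false \in B); last first.
  suff -> : B = nseq (size B) true by rewrite rev_nseq.
  elim: B {Bq} Bt => //= -[] B IH'; rewrite inE //= => /IH' E.
  by rewrite {1}E.
case/splitPr: Bf Bq => B1 B2; rewrite size_cat /= => Bq.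
rewrite rev_cat rev_cons cat_rcons !compo_cat perm_catC.
by apply: perm_cat; apply: IH; lia.
Qed.

Section Steps.
Variable d : nat -> nat.

Lemma steps_eq G G' p m : (forall c, c < m -> G' c = G c) ->
  steps G' d p m = steps G d p m.
Proof.
elim: m p => //= m IH p E; rewrite E // !IH // => c cm; exact/E/ltnW.
Qed.

(** At an unglued gap the counter restarts at 1, so the steps for the columns beyond it do not see
    how the earlier columns are glued. *)
Lemma steps_top G p c0 m : c0 <= m -> (c0 < m -> G c0 = false) -> (c0 = m -> p = 1) ->
  exists top, forall G', (forall c, c0 <= c < m -> G' c = G c) ->
    steps G' d p m = top ++ steps G' d 1 c0.
Proof.
elim: m p => [|m IH] p; rewrite leq_eqVlt => /orP[/eqP-> _ /(_ erefl) ->|lt Gc _] //.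
- by exists [::].
- by exists [::].
have [Em|ne] := eqVneq c0 m.
  exists (Some p :: nseq (d m) None) => G' E /=.
  by rewrite E ?Em ?leqnn // -Em Gc.
have lt' : c0 < m by lia.
case Gm : (G m).
  have [|||top T] := IH p.+1; [lia|by move=> _; apply: Gc|lia|].
  exists top => G' E /=; rewrite E ?Gm; last lia.
  by apply: T => c cm; apply: E; lia.
have [|||top T] := IH 1; [lia|by move=> _; apply: Gc|by []|].
exists (Some p :: nseq (d m) None ++ top) => G' E /=; rewrite E ?Gm; last lia.
by rewrite T ?catA // => c cm; apply: E; lia.
Qed.

(** Without row deletions the segment is a run of column additions. Column [a] belongs to the last
    block of that run, so its own entry is removed by [behead]. *)
Lemma steps_mid G p a l : (forall c, a <= c < a + l -> d c = 0) ->
  (0 < a -> G a.-1 = false) ->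
  steps G d p (a + l) =
  map Some (compo p [seq G c | c <- rev (iota a l)]) ++ behead (steps G d 1 a).
Proof.
move=> d0 Ga; elim: l p d0 => [|l IH] p d0.
  by rewrite addn0; case: a Ga {d0} => //= a /(_ isT) ->.
have d0' c : a <= c < a + l -> d c = 0 by move=> cl; apply: d0; lia.
rewrite addnS -[l.+1]addn1 iotaD rev_cat /= d0; last lia.
by case: (G (a + l)) => /=; rewrite IH.
Qed.

End Steps.

Section Constraints.
Variables (d : nat -> nat) (m k : nat).
Hypothesis k_gt0 : 0 < k.
Local Notation n := m.+1.
Local Notation la := (rows d n).
Local Notation constr := (seq (option bool)).

(* Some true (Some false) at position c requires a descent (an ascent) of the
   transversal between the columns c and c+1. *)
Fixpoint sat c (K : constr) (x : seq nat) : bool :=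
  match K with
  | [::] => true
  | o :: K1 => (if o is Some t then (index c.+1 x < index c x) == t else true)
               && sat c.+1 K1 x
  end.

Definition cnt b (K : constr) :=
  count (fun x => filling d m k b x && sat 0 K x) (words n (size la)).

Lemma sat_cat c K1 K2 x : sat c (K1 ++ K2) x = sat c K1 x && sat (c + size K1) K2 x.
Proof.
by elim: K1 c => [|o K1 IH] c /=; rewrite ?addn0 // IH andbA addSnnS.
Qed.

Lemma cnt_split b K1 K2 :
  cnt b (K1 ++ None :: K2) = cnt b (K1 ++ Some false :: K2) + cnt b (K1 ++ Some true :: K2).
Proof.
rewrite /cnt; elim: (words _ _) => //= x s ->; rewrite !sat_cat /=.
by case: (filling _ _ _ _ _); case: (sat 0 K1 x); case: (sat _ K2 x);
   case: (_ < _) => //=; lia.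
Qed.

(** Constraints only join columns of equal length, as no row ends between them. *)
Definition flat (K : constr) := forall c, nth false (map isSome K) c -> d c = 0.

Lemma satP c K x : reflect
  (forall i t, nth None K i = Some t -> (index (c + i).+1 x < index (c + i) x) = t)
  (sat c K x).
Proof.
elim: K c => [|o K IH] c /=; first by constructor=> i t; rewrite nth_nil.
apply: (iffP andP) => [[H1 /IH H2] [|i] t /= E|H].
- by move: H1; rewrite E addn0 => /eqP.
- by rewrite addnS -addSn; apply: H2.
split; first by case: o H => [t H|] //; have := H 0 t erefl; rewrite addn0 => ->.
by apply/IH => i t E; have := H i.+1 t E; rewrite addnS -addSn.
Qed.

Lemma filling_facts b x : x \in words n (size la) -> filling d m k b x ->
  uniq x /\ forall c, c < n -> c \in x.
Proof.
rewrite mem_words => /andP[_ rx] /fillingP[_ x1]; have px := perm_filling rx x1.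
by rewrite (perm_uniq px) iota_uniq; split=> // c cn; rewrite (perm_mem px) mem_iota.
Qed.

Lemma index_inj (x : seq nat) a c : a \in x -> index a x = index c x -> a = c.
Proof.
move=> ax E; rewrite -[LHS](nth_index 0 ax) E nth_index // -index_mem -E.
by rewrite index_mem.
Qed.

Lemma ord_pair_desc b c x : uniq x -> c \in x -> c.+1 \in x ->
  subseq (ord_pair b c c.+1) x = ((index c.+1 x < index c x) == b).
Proof.
move=> ux cx cx1; rewrite /ord_pair; case: b; rewrite subseq2_index // cx cx1 /=.
  by rewrite eqb_id (_ : (c.+1 != c)) //; lia.
rewrite (_ : (c != c.+1)) /=; last lia.
have ne : index c x != index c.+1 x.
  by apply/eqP => E; have := index_inj cx E; lia.
by rewrite eqbF_neg -leqNgt ltn_neqAle ne.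
Qed.

(** Constraints of the single kind [Some b] say exactly that the columns are glued in the order
    [ord_pair b]. *)
Lemma cnt_fills b K : size K = m -> flat K -> all (fun o => o != Some (~~ b)) K ->
  cnt b K = fills (av (ord_rel b) k)
              (all_steps (fun c => nth false (map isSome K) c) d m) [::].
Proof.
move=> sK fK aK; rewrite fills_filling; last by move=> c _; apply: fK.
rewrite /cnt; apply: eq_in_count => x xw; case Fx: (filling _ _ _ _ _) => //=.
have [ux memx] := filling_facts xw Fx.
have E c : c < m -> subseq (ord_pair b c c.+1) x = ((index c.+1 x < index c x) == b).
  by move=> cm; rewrite ord_pair_desc ?memx //; lia.
apply/satP/gluedP => [H c cm|H c t Ec].
  rewrite (nth_map None) ?sK // E //.
  case Ec : (nth None K c) => [t|] // _; rewrite (H c t Ec).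
  have := allP aK (nth None K c); rewrite mem_nth ?sK // Ec => /(_ isT).
  by case: (t) (b) => -[].
have cm : c < m by rewrite -sK ltnNge; apply: contraTN isT => le; rewrite nth_default in Ec.
have := allP aK (nth None K c); rewrite mem_nth ?sK // Ec => /(_ isT) tb.
have := H c cm; rewrite (nth_map None) ?sK // E // Ec => /(_ isT) /eqP ->.
by move: tb; case: (t) (b) => -[].
Qed.

Lemma Some_false_split (K : constr) : Some false \in K ->
  exists K1 K2, K = K1 ++ Some false :: K2.
Proof. by case/splitPr => K1 K2; exists K1, K2. Qed.

Lemma notin_false (K : constr) b : Some (~~ b) \notin K -> all (fun o => o != Some (~~ b)) K.
Proof. by move=> K0; apply/allP => o oK; apply: contraNneq K0 => <-. Qed.

Lemma flat_cat K1 K2 o t : flat (K1 ++ Some t :: K2) -> flat (K1 ++ o :: K2).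
Proof.
move=> F c; have := F c; rewrite !map_cat /= !nth_cat.
by case: ltnP => // _; case: (c - _) => //= H _; apply: H.
Qed.

(** An ascent is no constraint minus a descent, so induction leaves descents only on the left and
    ascents only on the right; both sides then have the same merged steps. *)
Lemma cnt_neg K : size K = m -> flat K -> cnt true K = cnt false (map (omap negb) K).
Proof.
have [q] := ubnP (count_mem (Some false) K); elim: q K => // q IH K Kq sK fK.
have [/Some_false_split[K1 [K2 EK]]|/(@notin_false _ true) K0] := boolP (Some false \in K).
  have E1 := cnt_split true K1 K2; have E2 := cnt_split false (map (omap negb) K1) (map (omap negb) K2).
  move: Kq sK fK; rewrite EK count_cat /= => Kq sK fK.
  have := IH (K1 ++ None :: K2); have := IH (K1 ++ Some true :: K2).
  rewrite !count_cat /= !size_cat /= -!sK size_cat !map_cat /=.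
  move=> /(_ ltac:(lia) erefl (flat_cat fK)) H1.
  move=> /(_ ltac:(lia) erefl (flat_cat fK)) H2.
  lia.
rewrite (cnt_fills sK fK K0) cnt_fills.
- rewrite fills_ltn_gtn //; congr fills; congr all_steps.
  by rewrite -map_comp (eq_map (g := isSome)) // => -[].
- by rewrite size_map.
- by move=> c cK; apply: fK; move: cK; rewrite -map_comp (eq_map (g := isSome)) // => -[].
by rewrite all_map; apply: sub_all K0 => -[[]|].
Qed.

Lemma map_nth_mid (s1 s2 s3 : seq bool) :
  [seq nth false (s1 ++ s2 ++ s3) c | c <- iota (size s1) (size s2)] = s2.
Proof.
apply: (@eq_from_nth _ false); rewrite size_map size_iota // => i is2.
rewrite (nth_map 0) ?size_iota // nth_iota // nth_cat ltnNge leq_addr /=.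
by rewrite addKn nth_cat is2.
Qed.

(* The merged columns of a segment delimited by unconstrained gaps may be
   permuted. *)
Lemma cnt_rev_seg K1 B K2 : size (K1 ++ B ++ K2) = m -> flat (K1 ++ B ++ K2) ->
  last None K1 = None -> head None K2 = None ->
  (forall c, size K1 <= c < size K1 + size B -> d c = 0) ->
  cnt true (K1 ++ B ++ K2) = cnt true (K1 ++ rev B ++ K2).
Proof.
have [q] := ubnP (count_mem (Some false) (K1 ++ B ++ K2)).
elim: q K1 B K2 => // q IH K1 B K2 Kq sK fK l1 h2 d0.
(* An ascent in any of the three parts is again written as no constraint minus a descent, and
   induction covers both terms. *)
have [/Some_false_split[U [V E]]|f1] := boolP (Some false \in K1).
  have step o : o != Some false -> cnt true (U ++ o :: V ++ B ++ K2) =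
      cnt true (U ++ o :: V ++ rev B ++ K2).
    move=> /negbTE oN; have := IH (U ++ o :: V) B K2; rewrite -!catA /=; apply=> //.
    - by move: Kq; rewrite E !count_cat /= ?count_cat /= oN; lia.
    - by rewrite -sK E !size_cat /= ?size_cat /=; lia.
    - by move: fK; rewrite E -!catA /=; apply: flat_cat.
    - by move: l1; rewrite E !last_cat /=; case: (V).
    by move=> c cl; apply: d0; rewrite E; move: cl; rewrite !size_cat.
  have := cnt_split true U (V ++ B ++ K2); have := cnt_split true U (V ++ rev B ++ K2).
  by rewrite E -!catA /= (step None) // (step (Some true)) // => -> /addIn ->.
have [/Some_false_split[U [V E]]|f2] := boolP (Some false \in B).
  have step o : o != Some false -> cnt true ((K1 ++ U) ++ o :: V ++ K2) =
      cnt true ((K1 ++ rev V) ++ o :: rev U ++ K2).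
    move=> /negbTE oN; have := IH K1 (U ++ o :: V) K2.
    rewrite rev_cat rev_cons cat_rcons -!catA /=; apply=> //.
    - by move: Kq; rewrite E !count_cat /= ?count_cat /= oN; lia.
    - by rewrite -sK E !size_cat /= ?size_cat /=; lia.
    - by move: fK; rewrite E -!catA !catA -!(catA (K1 ++ U)) /=; apply: flat_cat.
    by move=> c cl; apply: d0; rewrite E; move: cl; rewrite !size_cat.
  have := cnt_split true (K1 ++ U) (V ++ K2).
  have := cnt_split true (K1 ++ rev V) (rev U ++ K2).
  rewrite E rev_cat rev_cons cat_rcons (step None) // (step (Some true)) //.
  by rewrite -!catA /= => -> /addIn ->.
have [/Some_false_split[U [V E]]|f3] := boolP (Some false \in K2).
  have step o : o != Some false -> cnt true ((K1 ++ B ++ U) ++ o :: V) =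
      cnt true ((K1 ++ rev B ++ U) ++ o :: V).
    move=> /negbTE oN; have := IH K1 B (U ++ o :: V); rewrite -!catA /=; apply=> //.
    - by move: Kq; rewrite E !count_cat /= oN; lia.
    - by rewrite -sK E !size_cat /= ?size_cat /=; lia.
    - by move: fK; rewrite E !catA; apply: flat_cat.
    by move: h2; rewrite E; case: (U).
  have := cnt_split true (K1 ++ B ++ U) V; have := cnt_split true (K1 ++ rev B ++ U) V.
  by rewrite E (step None) // (step (Some true)) // -!catA /= => -> /addIn ->.
(* Only gluings remain. The steps of both sides agree outside the segment, and inside it they are
   runs of column additions with permuted sums. *)
have allK : all (fun o => o != Some (~~ true)) (K1 ++ B ++ K2).
  by apply: (@notin_false _ true); rewrite !mem_cat !negb_or f1 f2 f3.
have allK' : all (fun o => o != Some (~~ true)) (K1 ++ rev B ++ K2).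
  by move: allK; rewrite !all_cat all_rev.
set K := K1 ++ B ++ K2 in sK fK allK *; set K' := K1 ++ rev B ++ K2 in allK' *.
have sK' : size K' = m by rewrite -sK /K' !size_cat size_rev.
pose G c := nth false (map isSome K) c; pose G' c := nth false (map isSome K') c.
pose a := size K1; pose l := size B.
have GG' c : ~~ (a <= c < a + l) -> G' c = G c.
  rewrite /G /G' /K /K' !map_cat !nth_cat !size_map size_rev -/a -/l => ac.
  by case: ltnP => // ?; have -> : (c - a < l) = false by lia.
have fK' : flat K'.
  move=> c; have [/d0 //|/GG' E] := boolP (a <= c < a + l).
  by rewrite -/(G' c) E; apply: fK.
have alm : a + l <= m by rewrite -sK !size_cat addnA leq_addr.
have [||//|top T] := @steps_top d G 1 (a + l) m.
- by [].
- move=> lt; rewrite /G /K catA map_cat nth_cat size_map size_cat -/a -/l ltnn subnn.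
  by case: (K2) h2 => // o K2' /= ->.
have Ga : 0 < a -> G a.-1 = false.
  rewrite /G /K /a; case/lastP: (K1) l1 => // K0 o; rewrite last_rcons => -> _.
  by rewrite size_rcons cat_rcons map_cat nth_cat size_map ltnn subnn.
have Ga' : 0 < a -> G' a.-1 = false by move=> a0; rewrite GG' ?Ga //; lia.
rewrite (cnt_fills sK fK allK) (cnt_fills sK' fK' allK') /= /all_steps.
rewrite -/G -/G' !T //; last by move=> c cl; apply: GG'; lia.
rewrite !steps_mid // (steps_eq d 1 (G := G) (G' := G')); last by move=> c cl; apply: GG'; lia.
rewrite !catA -!(catA (nseq _ _)) -!catA !(catA (nseq _ _)); apply: fills_perm => //.
have -> : [seq G c | c <- rev (iota a l)] = rev (map isSome B).
  rewrite map_rev; congr rev.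
  by have := map_nth_mid (map isSome K1) (map isSome B) (map isSome K2); rewrite !size_map -!map_cat.
have -> : [seq G' c | c <- rev (iota a l)] = map isSome B.
  rewrite map_rev -[B in RHS]revK [RHS]map_rev; congr rev.
  have := map_nth_mid (map isSome K1) (map isSome (rev B)) (map isSome K2).
  by rewrite !size_map size_rev -!map_cat.
exact: compo_rev.
Qed.

(** * Reversing chains of peaks into chains of valleys *)

Inductive zigzag : constr -> constr -> Prop :=
| ZigNil : zigzag [::] [::]
| ZigNone K K' : zigzag K K' -> zigzag (None :: K) (None :: K')
| ZigPeak K K' : zigzag K K' ->
    zigzag [:: Some false, Some true & K] [:: Some true, Some false & K'].

Definition zig l : constr := flatten (nseq l [:: Some false; Some true]).
Definition zag l : constr := flatten (nseq l [:: Some true; Some false]).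

Lemma zagS l : zag l.+1 = rcons (rcons (zag l) (Some true)) (Some false).
Proof. by elim: l => // l IH; rewrite -[LHS]/([:: Some true, Some false & zag l.+1]) {1}IH. Qed.

Lemma rev_zig l : rev (zig l) = zag l.
Proof. by elim: l => // l IH; rewrite zagS -IH /= 2!rev_cons. Qed.

Lemma isSome_zig l : map isSome (zig l) = nseq l.*2 true.
Proof. by elim: l => //= l ->. Qed.

Lemma isSome_zag l : map isSome (zag l) = nseq l.*2 true.
Proof. by elim: l => //= l ->. Qed.

Lemma size_zig l : size (zig l) = l.*2.
Proof. by rewrite -(size_map isSome) isSome_zig size_nseq. Qed.

Lemma zigzag_block K K' : zigzag K K' -> exists l,
  (K = zig l /\ K' = zag l) \/
  exists K1 K1', [/\ zigzag K1 K1', K = zig l ++ None :: K1 & K' = zag l ++ None :: K1'].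
Proof.
elim=> [|K1 K1' Z _|K1 K1' _ [l [[-> ->]|[K2 [K2' [Z -> ->]]]]]].
- by exists 0; left.
- by exists 0; right; exists K1, K1'.
- by exists l.+1; left.
by exists l.+1; right; exists K2, K2'.
Qed.

(** Maximal chains are reversed one at a time from the left; [K0] is the part already treated and
    ends in an unconstrained gap. *)
Lemma cnt_zigzag K0 K K' : zigzag K K' -> size (K0 ++ K) = m -> flat (K0 ++ K) ->
  last None K0 = None -> cnt true (K0 ++ K) = cnt true (K0 ++ K').
Proof.
have [q] := ubnP (size K); elim: q K0 K K' => // q IH K0 K K' Kq Z sK fK l0.
have seg l K2 : size (K0 ++ zig l ++ K2) = m -> flat (K0 ++ zig l ++ K2) ->
    head None K2 = None -> cnt true (K0 ++ zig l ++ K2) = cnt true (K0 ++ zag l ++ K2).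
  move=> sK' fK' h2; rewrite cnt_rev_seg ?rev_zig // => c cl; apply: fK'.
  rewrite !map_cat nth_cat size_map ltnNge (proj1 (andP cl)) /=.
  rewrite nth_cat isSome_zig size_nseq nth_nseq.
  by have -> : c - size K0 < l.*2 by move: cl; rewrite size_zig; lia.
have [l [[EK EK']|[K1 [K1' [Z1 EK EK']]]]] := zigzag_block Z.
  have := seg l [::]; rewrite cats0 -EK => /(_ sK fK erefl) ->.
  by rewrite cats0 EK'.
have := seg l (None :: K1); rewrite -EK => /(_ sK fK erefl) ->.
have assoc U : K0 ++ zag l ++ None :: U = (K0 ++ zag l ++ [:: None]) ++ U.
  by rewrite -!catA.
rewrite EK' (assoc K1) (assoc K1'); apply: IH => //.
- by move: Kq; rewrite EK size_cat /=; lia.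
- rewrite -assoc -sK EK !size_cat size_zig /= -(size_map isSome (zag l)) isSome_zag.
  by rewrite size_nseq.
- by rewrite -assoc => c; move: (fK c); rewrite EK !map_cat isSome_zig isSome_zag.
by rewrite !last_cat.
Qed.

Section Peaks.
Variable S : pred nat.
Hypothesis Sadj : forall i, S i -> ~~ S i.+1.
Hypothesis Sm : forall i, S i -> 0 < i < m.

Definition peak_at c := if S c then Some true else if S c.+1 then Some false else None.
Definition val_at c := omap negb (peak_at c).
Definition peak_constr := map peak_at (iota 0 m).

Lemma zigzag_peaks c l : c + l = m -> ~~ S c ->
  zigzag (map peak_at (iota c l)) (map val_at (iota c l)).
Proof.
have [q] := ubnP l; elim: q l c => // q IH [|l] c lq cl Sc; first exact: ZigNil.
rewrite /= /val_at /peak_at (negbTE Sc) -/(peak_at _).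
case Sc1: (S c.+1); last by apply: ZigNone; apply: IH; rewrite ?Sc1 //; lia.
have /andP[_ cm] := Sm Sc1; have Sc2 := Sadj Sc1.
case: l lq cl => [|l] lq cl; first lia.
rewrite /= Sc1; apply: ZigPeak; apply: IH => //; lia.
Qed.

Hypothesis Sflat : forall i, S i -> d i.-1 = 0 /\ d i = 0.

Lemma size_peak : size peak_constr = m. Proof. by rewrite size_map size_iota. Qed.

Lemma flat_peak : flat peak_constr.
Proof.
move=> c; rewrite /peak_constr -map_comp.
have [cm|mc] := ltnP c m; last by rewrite nth_default // size_map size_iota.
rewrite (nth_map 0) ?size_iota // nth_iota //= add0n /peak_at.
case Sc: (S c); first by case: (Sflat Sc).
by case Sc1: (S c.+1) => //; case: (Sflat Sc1).
Qed.

Lemma cnt_peak_val : cnt true peak_constr = cnt true (map (omap negb) peak_constr).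
Proof.
rewrite /peak_constr -map_comp; apply: (@cnt_zigzag [::]) => //.
- by apply: zigzag_peaks => //; apply/negP => /Sm.
- exact: size_peak.
exact: flat_peak.
Qed.

Lemma cnt_peak_swap : cnt true peak_constr = cnt false (map (omap negb) peak_constr).
Proof. by apply: cnt_neg; [exact: size_peak|exact: flat_peak]. Qed.

Lemma cnt_val_swap : cnt true (map (omap negb) peak_constr) = cnt false peak_constr.
Proof.
rewrite cnt_neg ?size_map ?size_iota //.
  congr cnt; rewrite -map_comp -[RHS]map_id; apply: eq_map => -[[]|] //.
move=> c; rewrite -map_comp (eq_map (g := isSome)); first exact: flat_peak.
by case.
Qed.

End Peaks.

End Constraints.

(** * Transversals *)

Lemma geq_trans : transitive geq. Proof. by move=> y x z /= h1 h2; apply: leq_trans h2 h1. Qed.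

Lemma rows_sorted d m : sorted geq (rows d m).
Proof.
rewrite (sorted_pairwise geq_trans); elim: m => //= m IH.
rewrite pairwise_cat IH andbT; apply/andP; split.
  apply/allrelP => x y; rewrite mem_nseq => /andP[_ /eqP ->] /rowsP[_ ym _] /=.
  exact: leqW.
by elim: (d m) => //= q ->; rewrite andbT; apply/allP => x; rewrite mem_nseq => /andP[_ /eqP ->] /=.
Qed.

Lemma count_rows d m c : count_mem c.+1 (rows d m) = if c < m then d c else 0.
Proof.
elim: m => //= m IH; rewrite count_cat IH count_nseq /= eqSS ltnS eq_sym.
by case: (ltngtP c m) => [_|_|->]; rewrite ?addn0 ?mul1n.
Qed.

Lemma rows_partition la : is_partition la ->
  rows (fun c => count_mem c.+1 la) (ncols la) = la.
Proof.
move=> /andP[sla la0]; apply: (sorted_eq geq_trans _ (rows_sorted _ _) sla).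
  by move=> x y /= /anti_leq.
rewrite /perm_eq; apply/allP => -[|c] _; apply/eqP.
  rewrite !(count_memPn _) //; apply/negP => /rowsP[] //.
rewrite count_rows; case: ltnP => // le; apply: esym; apply/count_memPn/negP => cl.
move: le; rewrite /ncols; case: la sla la0 cl => //= a la pa _.
rewrite inE => /predU1P[<-|{}cl]; first by rewrite ltnn.
have /allP/(_ _ cl) /= := order_path_min geq_trans pa; lia.
Qed.

Section Transversals.
Variables (d : nat -> nat) (m k : nat).
Local Notation n := m.+1.
Local Notation la := (rows d n).
Local Notation N := (size la).
Hypothesis n_cols : ncols la = n.
Hypothesis k_gt0 : 0 < k.

Definition shaped (x : seq nat) :=
  all (fun j => nth 0 x j < nth 0 la j) (iota 0 N) && all (fun c => occ c x == 1) (iota 0 n).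

Definition tr (x : seq nat) : {set box la} := [set s : box la | nth 0 x s.2 == s.1].

Lemma shapedP x : reflect
  ((forall j, j < N -> nth 0 x j < nth 0 la j) /\ (forall c, c < n -> occ c x = 1))
  (shaped x).
Proof.
apply: (iffP andP) => -[H1 H2]; split.
- by move=> j jN; apply: (allP H1); rewrite mem_iota.
- by move=> c cn; apply/eqP/(allP H2); rewrite mem_iota.
- by apply/allP => j; rewrite mem_iota => /H1.
by apply/allP => c; rewrite mem_iota => /H2 ->.
Qed.

Lemma box_lt (s : box la) : s.1 < n. Proof. by rewrite -[X in _ < X]n_cols. Qed.

Lemma words_lt x j : x \in words n N -> nth 0 x j < n.
Proof.
rewrite mem_words => /andP[/eqP sx rx]; have [jN|?] := ltnP j N.
  by apply: (allP rx); rewrite mem_nth ?sx.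
by rewrite nth_default ?sx.
Qed.

Lemma col_ordP c : c < n -> c < ncols la. Proof. by rewrite n_cols. Qed.

Lemma tr_inj : {in words n N &, injective tr}.
Proof.
move=> x y xw yw /setP E; have := xw; have := yw.
rewrite !mem_words => /andP[/eqP sy _] /andP[/eqP sx _].
apply: (@eq_from_nth _ 0); rewrite ?sx ?sy // => j jN.
have := E (Ordinal (col_ordP (words_lt j xw)), Ordinal jN).
by rewrite !inE /= eqxx => /esym/eqP.
Qed.

Lemma card_col_tr x c (cn : c < ncols la) : x \in words n N ->
  #|[set s in tr x | s.1 == Ordinal cn]| = occ c x.
Proof.
rewrite mem_words => /andP[/eqP sx _].
have -> : [set s in tr x | s.1 == Ordinal cn] =
    [set (Ordinal cn, j) | j in [set j : 'I_N | nth 0 x j == c]].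
  apply/setP => -[i j]; rewrite !inE /=; apply/andP/imsetP => [[/eqP xj /eqP ic]|[j' ]].
    by exists j; rewrite ?inE ?xj ?ic.
  by rewrite inE => /eqP xj [-> ->]; rewrite eqxx /= xj.
rewrite card_imset => [|j j' [] //]; rewrite /occ -[in RHS](mkseq_nth 0 x) sx.
rewrite /mkseq -val_enum_ord -map_comp count_map cardsE cardE size_filter.
by rewrite -enumT.
Qed.

Lemma tr_transversal x : x \in words n N -> shaped x -> tr x \in transversals la.
Proof.
move=> xw /shapedP[xl x1]; rewrite inE; apply/and3P; split.
- by apply/subsetP => s; rewrite !inE => /eqP <-; apply: xl.
- by apply/forallP => -[i ic]; rewrite card_col_tr // x1 // -n_cols.
apply/forallP => j; apply/cards1P.
exists (Ordinal (col_ordP (words_lt j xw)), j); apply/setP => -[i j'].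
rewrite !inE /= xpair_eqE; case: (eqVneq j' j) => [->|_]; rewrite ?andbF // !andbT.
by rewrite -val_eqE /= eq_sym.
Qed.

Lemma transversal_tr T : T \in transversals la ->
  exists2 x, x \in words n N & shaped x /\ T = tr x.
Proof.
rewrite inE => /and3P[/subsetP Td Tc Tr].
have row j : exists s : box la, [set s in T | s.2 == j] = [set s].
  by apply/cards1P; apply: (forallP Tr).
pose f (j : nat) := \sum_(s in T | s.2 == j :> nat) s.1.
have fE (j : 'I_N) : exists2 s : box la, [set s in T | s.2 == j] = [set s] & f j = s.1.
  have [s Es] := row j; exists s => //; rewrite /f (big_pred1 s) // => s'.
  by have /setP/(_ s') := Es; rewrite !inE.
have fT (s : box la) : (s \in T) = (f s.2 == s.1).
  have [s' Es ->] := fE s.2; have /setP/(_ s) := Es; rewrite !inE eqxx andbT => ->.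
  have : s' \in [set s'] by rewrite inE.
  rewrite -Es inE => /andP[_ /eqP]; case: s s' {Es} => i j [i' j'] /= ->.
  by rewrite xpair_eqE eqxx andbT -val_eqE eq_sym.
have xw : mkseq f N \in words n N.
  rewrite mem_words size_mkseq eqxx; apply/allP => c /mapP[j].
  rewrite mem_iota => /= jN ->; have [s _ ->] := fE (Ordinal jN); exact: box_lt.
have ET : T = tr (mkseq f N).
  by apply/setP => s; rewrite fT inE nth_mkseq.
exists (mkseq f N) => //; split=> //; apply/shapedP; split=> [j jN|c cn].
  have [s Es fs] := fE (Ordinal jN); rewrite nth_mkseq // fs.
  have : s \in [set s] by rewrite inE.
  by rewrite -Es inE => /andP[/Td]; rewrite inE => lt /eqP E; move: lt; rewrite E.
have := forallP Tc (Ordinal (col_ordP cn)); rewrite ET card_col_tr // => /eqP.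
by [].
Qed.

Definition pat b : 'S_k := if b then Ipat k else Jpat k.

Let tau b (i : 'I_k) := if b then i else rev_ord i.

Lemma patE b i : pat b i = tau b i.
Proof. by rewrite /pat /tau; case: b; rewrite ?perm1 // permE. Qed.

Lemma tauK b : involutive (tau b).
Proof. by rewrite /tau; case: b => // i; rewrite rev_ordK. Qed.

Lemma sorted_subseq_iota s q : sorted ltn s -> all (gtn q) s -> subseq s (iota 0 q).
Proof.
move=> ss sq; rewrite (_ : s = [seq i <- iota 0 q | i \in s]) ?filter_subseq //.
apply: (irr_sorted_eq ltn_trans ltnn ss) => [|i].
  exact: (sorted_filter ltn_trans _ (iota_ltn_sorted _ _)).
by rewrite mem_filter mem_iota; case: (boolP (i \in s)) => //= /(allP sq).
Qed.

Lemma ord_rel_trans b : transitive (ord_rel b).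
Proof. by case: b => y x z /= h1 h2; [exact: ltn_trans h1 h2|exact: ltn_trans h2 h1]. Qed.

(** The last row of an occurrence is the shortest one, so all squares of the occurrence lie in the
    diagram as soon as its columns meet that row. *)
Lemma contains_chain b x : x \in words n N -> shaped x ->
  contains (pat b) (tr x) =
  ~~ all (fun j => av (ord_rel b) k [seq c <- take j.+1 x | c < nth 0 la j]) (iota 0 N).
Proof.
move=> xw /shapedP[xl x1]; have := xw; rewrite mem_words => /andP[/eqP sx rx].
have k1 : k.-1 < k by lia.
apply/existsP/allPn => [[r /existsP[c /and4P[rinc cinc inD pT]]]|[j]].
  pose jm := r (Ordinal k1).
  exists (jm : nat); first by rewrite mem_iota /=.
  rewrite negbK; apply/chainP.
  have xr i : nth 0 x (r (tau b i)) = c i.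
    have /forallP/(_ (tau b i)) := forallP pT i.
    by rewrite patE eqxx inE => /eqP/eqP.
  have xr' i : nth 0 x (r i) = c (tau b i) by rewrite -xr tauK.
  have rlt (i j : 'I_k) : i < j -> r i < r j.
    by move=> ij; have /forallP/(_ j)/implyP/(_ ij) := forallP rinc i.
  have clt (i j : 'I_k) : i < j -> c i < c j.
    by move=> ij; have /forallP/(_ j)/implyP/(_ ij) := forallP cinc i.
  have iE : sorted ltn (map val (enum 'I_k)) by rewrite val_enum_ord iota_ltn_sorted.
  exists [seq nth 0 x (r i) | i <- enum 'I_k]; split; last by rewrite size_map size_enum_ord.
    rewrite subseq_filter; apply/andP; split.
      apply/allP => y /mapP[i _ ->]; rewrite xr'.
      by have /forallP/(_ (Ordinal k1)) := forallP inD (tau b i); rewrite inE.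
    rewrite -(map_nth_iota0 0) ?sx // (map_comp (nth 0 x) (fun i => r i : nat)).
    apply/map_subseq/sorted_subseq_iota.
      by move: iE; rewrite !sorted_map; apply: sub_sorted => i j /=; apply: rlt.
    apply/allP => y /mapP[i _ ->] /=; rewrite ltnS leq_eqVlt.
    have [->|ne] := eqVneq i (Ordinal k1); first by rewrite eqxx.
    rewrite rlt ?orbT //=; move: ne; rewrite -val_eqE /=; have := ltn_ord i; lia.
  move: iE; rewrite !sorted_map; apply: sub_sorted => i j /= ij.
  rewrite !xr' /tau /ord_rel; case: (b) => /=; apply: clt => //=.
  by have := ltn_ord j; lia.
rewrite mem_iota negbK => /= jN /chainP[s [sub srt sz]].
move: sub; rewrite subseq_filter => /andP[sl sub].
have us : uniq s.
  by apply: sorted_uniq srt; [exact: ord_rel_trans|rewrite /ord_rel; case: (b) => i; apply: ltnn].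
move: sub; rewrite -(map_nth_iota0 0) ?sx // => /subseqP[mk _ Es].
pose idx := mask mk (iota 0 j.+1).
have {}Es : s = [seq nth 0 x i | i <- idx] by rewrite Es map_mask.
have szi : size idx = k by rewrite -sz Es size_map.
have sidx : sorted ltn idx by apply: sorted_mask (iota_ltn_sorted _ _); apply: ltn_trans.
have lidx i : i \in idx -> i <= j by move/mem_mask; rewrite mem_iota.
have rP (i : 'I_k) : nth 0 idx i < N.
  by apply: leq_ltn_trans jN; apply: lidx; rewrite mem_nth // szi.
have sE i : i < k -> nth 0 s i = nth 0 x (nth 0 idx i).
  by move=> ik; rewrite Es (nth_map 0) // szi.
have cP (i : 'I_k) : nth 0 s (tau b i) < ncols la.
  by rewrite n_cols sE //; apply: words_lt.
have ltn_nth (e : rel nat) (l : seq nat) i i' : transitive e -> sorted e l -> i < i' -> i' < size l ->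
    e (nth 0 l i) (nth 0 l i').
  by move=> te se ii il; apply: (sorted_ltn_nth te 0 se) => //; rewrite inE //; lia.
exists [ffun i => Ordinal (rP i)]; apply/existsP; exists [ffun i => Ordinal (cP i)].
apply/and4P; split.
- apply/forallP => i; apply/forallP => i'; apply/implyP => ii; rewrite !ffunE /=.
  by apply: (ltn_nth ltn) => //; [exact: ltn_trans|rewrite szi].
- apply/forallP => i; apply/forallP => i'; apply/implyP => ii; rewrite !ffunE /=.
  have := ltn_ord i; have := ltn_ord i'; move: srt; rewrite /tau /ord_rel.
  case: (b) => srt ik' ik.
    by apply: (ltn_nth ltn) => //; [exact: ltn_trans|rewrite sz].
  apply: (ltn_nth gtn) => //=; [exact: (@ord_rel_trans false)|lia|rewrite sz; lia].
- apply/forallP => i; apply/forallP => i'; rewrite !ffunE inE /=.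
  have s1 : nth 0 s (tau b i) \in s by rewrite mem_nth // sz.
  have := allP sl _ s1; move=> /= lt; apply: leq_trans lt _.
  have ij : nth 0 idx i' <= j by apply: lidx; rewrite mem_nth // szi.
  have := rows_sorted d n; move/(sorted_leq_nth geq_trans (fun x => leqnn x) 0).
  by apply; rewrite ?inE //; apply: leq_ltn_trans jN.
apply/forallP => i; apply/forallP => i'; rewrite !ffunE inE /= patE -sE //.
by rewrite nth_uniq ?sz // -val_eqE.
Qed.

Lemma card_avoiders b (Q : pred {set box la}) :
  #|[set T in avoiders la (pat b) | Q T]| =
  count (fun x => filling d m k b x && Q (tr x)) (words n N).
Proof.
have fE x : x \in words n N ->
    filling d m k b x = shaped x && ~~ contains (pat b) (tr x).
  move=> xw; case Sx : (shaped x) => /=.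
    rewrite contains_chain // negbK; move/shapedP: Sx => [xl x1].
    apply/fillingP/allP => [[H _] j|H]; first by rewrite mem_iota => /H[].
    by split=> // j jN; split; [exact: xl|apply: H; rewrite mem_iota].
  apply/negP => /fillingP[H1 H2]; case/negP: (negbT Sx); apply/shapedP.
  by split=> // j /H1[].
rewrite -size_filter -(size_map tr) -(card_uniqP _); last first.
  rewrite map_inj_in_uniq ?filter_uniq ?words_uniq // => x y.
  by rewrite !mem_filter => /andP[_ xw] /andP[_ yw]; apply: tr_inj.
apply: eq_card => T; rewrite inE [T \in avoiders _ _]inE; apply/andP/mapP => [[/andP[TT av]] QT|[x]].
  have [x xw [Sx ET]] := transversal_tr TT; exists x => //.
  by rewrite mem_filter xw fE // Sx -ET av QT.
rewrite mem_filter => /andP[/andP[Fx Qx] xw] ->; move: Fx; rewrite fE // => /andP[Sx ->].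
by rewrite tr_transversal.
Qed.

Lemma one_row_tr b x c : x \in words n N -> filling d m k b x -> c < n ->
  one_row (tr x) c = index c x.
Proof.
move=> xw Fx cn; have [ux memx] := filling_facts xw Fx.
have := xw; rewrite mem_words => /andP[/eqP sx _].
have iN : index c x < N by rewrite -sx index_mem memx.
rewrite /one_row (big_pred1 (Ordinal (col_ordP cn), Ordinal iN)) // => -[i j].
rewrite inE /= xpair_eqE -!val_eqE /= andbC; case: eqP => // -> /=.
by apply/eqP/eqP => [<-|->]; rewrite ?index_uniq ?sx // nth_index // memx.
Qed.

Lemma col_len_S c : col_len la c = col_len la c.+1 + count_mem c.+1 la.
Proof.
rewrite /col_len; elim: la => //= r s ->.
by case: (ltngtP r c.+1) => /=; case: (ltngtP c r) => /=; lia.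
Qed.

Lemma flat_atE c : flat_at la c = [&& 0 < c < m, d c.-1 == 0 & d c == 0].
Proof.
have dE i : i < n -> (col_len la i == col_len la i.+1) = (d i == 0).
  move=> im; rewrite col_len_S count_rows im; lia.
rewrite /flat_at n_cols ltnS; case: c => //= c; case cm : (c.+1 < m) => //=.
by rewrite !dE //; lia.
Qed.

Definition PV t (T : {set box la}) := if t then Peak T else Val T.

Lemma mem_PV b t x i : x \in words n N -> filling d m k b x ->
  (i \in PV t (tr x)) =
  flat_at la i && (((index i.+1 x < index (i : nat) x) == t) &&
                   ((index (i : nat) x < index i.-1 x) == ~~ t)).
Proof.
move=> xw Fx; have [ux memx] := filling_facts xw Fx.
(* Different columns have their ones in different rows, so failing to be a descent means being an
   ascent. *)
have ne a c : a < n -> c < n -> a != c -> index a x != index c x.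
  by move=> an cn; apply: contra => /eqP E; apply/eqP; apply: index_inj E; apply: memx.
rewrite /PV (fun_if (fun A : {set 'I_(ncols la)} => i \in A)) !inE.
case f : (flat_at la i); last by case: t.
move: f; rewrite flat_atE => /= /and3P[/andP[i0 im] _ _].
move: (nat_of_ord i) i0 im => c c0 cm.
rewrite !(one_row_tr xw Fx) //; try lia.
have : index c.-1 x != index c x by apply: ne; lia.
have : index c.+1 x != index c x by apply: ne; lia.
by move: (index c.-1 x) (index c x) (index c.+1 x) => u v w; case: t => /=; lia.
Qed.

(** * Transversals whose peaks or valleys contain a given set *)

Section Subset.
Variable S : {set 'I_(ncols la)}.

Definition in_S (c : nat) := [exists i in S, i == c :> nat].

Lemma in_SP c : reflect (exists2 i : 'I_(ncols la), i \in S & i = c :> nat) (in_S c).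
Proof. by apply: (iffP exists_inP) => -[i iS /eqP E]; exists i => //; apply/eqP. Qed.

Definition cnt_sub b t :=
  count (fun x => filling d m k b x && (S \subset PV t (tr x))) (words n N).

Definition sparse := [forall i in S, flat_at la i && ~~ in_S i.+1].

Lemma cnt_sub_sparse b t : sparse ->
  cnt_sub b t = cnt d m k b (map (omap (fun u => u == t)) (peak_constr m in_S)).
Proof.
move=> /forall_inP sp; apply: eq_in_count => x xw; case Fx: (filling _ _ _ _ _) => //=.
have [ux memx] := filling_facts xw Fx.
have nthK c : nth None (map (omap (fun u => u == t)) (peak_constr m in_S)) c =
    if c < m then omap (fun u => u == t) (peak_at in_S c) else None.
  case: ltnP => cm; last by rewrite nth_default // !size_map size_iota.
  by rewrite (nth_map None) ?size_map ?size_iota // (nth_map 0) ?size_iota // nth_iota.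
apply/subsetP/satP => [H c u|H i iS].
  rewrite nthK add0n; case: ltnP => // cm; rewrite /peak_at.
  case: in_SP => [[i iS <-] /= [<-]|_].
    by have := H i iS; rewrite (mem_PV _ _ xw Fx) => /and3P[_ /eqP -> _]; case: (t).
  case: in_SP => //= -[i iS Ei] [<-]; have := H i iS.
  by rewrite (mem_PV _ _ xw Fx) Ei => /and3P[_ _ /eqP ->]; case: (t).
have /andP[fi Ni] := sp i iS; rewrite (mem_PV _ _ xw Fx) fi /=.
move: fi; rewrite flat_atE => /andP[/andP[i0 im] _].
have Si : in_S i by apply/in_SP; exists i.
apply/andP; split; apply/eqP.
  have := H i (true == t); rewrite nthK im /peak_at Si add0n => /(_ erefl) ->.
  by case: (t).
have Ni' : in_S i.-1 = false.
  apply/in_SP => -[j jS Ej]; have /andP[_] := sp j jS.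
  by rewrite Ej prednK // Si.
have := H i.-1 (false == t); rewrite nthK add0n prednK // /peak_at Ni' prednK // Si.
by rewrite (ltnW im) => /(_ erefl) ->; case: (t).
Qed.

(** Two adjacent peaks would require both a descent and an ascent at the gap between them; the same
    holds for valleys. *)
Lemma cnt_sub_nsparse b t : ~~ sparse -> cnt_sub b t = 0.
Proof.
move=> /forall_inPn[i iS ns]; apply/eqP; rewrite -leqn0 leqNgt -has_count -all_predC.
apply/allP => x xw /=; apply/negP => /andP[Fx /subsetP sub].
have := sub i iS; rewrite (mem_PV _ _ xw Fx) => /and3P[fi /eqP E _].
move: ns; rewrite fi /= negbK => /in_SP[j jS Ej].
have := sub j jS; rewrite (mem_PV _ _ xw Fx) Ej E => /and3P[_ _].
by case: (t).
Qed.

Lemma sparse_facts : sparse ->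
  [/\ forall i, in_S i -> ~~ in_S i.+1, forall i, in_S i -> 0 < i < m
    & forall i, in_S i -> d i.-1 = 0 /\ d i = 0].
Proof.
move=> /forall_inP sp; split=> i /in_SP[j jS <-]; have /andP[fj ?] := sp j jS => //;
  by move: fj; rewrite flat_atE => /and3P[? /eqP ? /eqP].
Qed.

Lemma peak_constr_id : map (omap (fun u => u == true)) (peak_constr m in_S) = peak_constr m in_S.
Proof. by rewrite -[RHS]map_id; apply: eq_map => -[[]|]. Qed.

Lemma peak_constr_neg : map (omap (fun u => u == false)) (peak_constr m in_S) =
  map (omap negb) (peak_constr m in_S).
Proof. by apply: eq_map => -[[]|]. Qed.

Lemma cnt_sub_eq b t b' t' : cnt_sub b t = cnt_sub b' t'.
Proof.
have [sp|ns] := boolP sparse; last by rewrite !cnt_sub_nsparse.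
have [adj rng flt] := sparse_facts sp.
have E1 := cnt_peak_val k_gt0 adj rng flt.
have E2 := cnt_peak_swap m k_gt0 flt.
have E3 := cnt_val_swap m k_gt0 flt.
suff H u v : cnt_sub u v = cnt_sub true true by rewrite (H b t) (H b' t').
rewrite !cnt_sub_sparse // peak_constr_id; case: u; case: v;
  rewrite ?peak_constr_id ?peak_constr_neg; congruence.
Qed.

End Subset.

Lemma card_sub_PV (S : {set 'I_(ncols la)}) b t :
  #|[set T in avoiders la (pat b) | S \subset PV t T]| = cnt_sub S b t.
Proof. exact: card_avoiders. Qed.

End Transversals.

(** * Inclusion-exclusion on monomials *)

Section Monomials.
Local Open Scope ring_scope.

(** Expanding each factor as (t_i - 1) + 1 reduces equality of generating functions to counting the
    transversals whose peak or valley set contains a given [S]. *)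
Lemma tmon_subsets n (A : {set 'I_n}) :
  tmon A = \sum_(S : {set 'I_n}) (S \subset A)%:R * \prod_(i in S) ('X_i - 1) :> {mpoly int[n]}.
Proof.
rewrite /tmon big_mkcond /=.
transitivity (\prod_(i < n) ((if i \in A then 'X_i - 1 else 0) + 1) : {mpoly int[n]}).
  by apply: eq_bigr => i _; case: ifP => _; rewrite ?subrK ?add0r.
rewrite bigA_distr; apply: eq_bigr => S _.
have [SA|/subsetPn[i iS iA]] := boolP (S \subset A); last first.
  by rewrite mul0r (bigD1 i) //= iS (negbTE iA) mul0r.
rewrite mul1r [RHS]big_mkcond; apply: eq_bigr => i _; case: ifP => // iS.
by rewrite (subsetP SA).
Qed.

Lemma sum_tmon_eq (U : finType) n (A B : {set U}) (P Q : U -> {set 'I_n}) :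
  (forall S : {set 'I_n}, #|[set T in A | S \subset P T]| = #|[set T in B | S \subset Q T]|) ->
  \sum_(T in A) tmon (P T) = \sum_(T in B) tmon (Q T).
Proof.
move=> E.
have F (C : {set U}) (R : U -> {set 'I_n}) : \sum_(T in C) tmon (R T) = \sum_(S : {set 'I_n})
    #|[set T in C | S \subset R T]|%:R * \prod_(i in S) ('X_i - 1) :> {mpoly int[n]}.
  under eq_bigr do rewrite tmon_subsets.
  rewrite exchange_big; apply: eq_bigr => S _; rewrite -mulr_suml; congr (_ * _).
  rewrite -sum1_card natr_sum big_mkcond [RHS]big_mkcond; apply: eq_bigr => T _.
  by rewrite inE; case: (T \in C); case: (S \subset R T).
by rewrite !F; apply: eq_bigr => S _; rewrite E.
Qed.

End Monomials.

Lemma card_PV la k (S : {set 'I_(ncols la)}) b t b' t' : is_partition la -> 0 < k ->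
  #|[set T in avoiders la (if b then Ipat k else Jpat k) | S \subset if t then Peak T else Val T]| =
  #|[set T in avoiders la (if b' then Ipat k else Jpat k) | S \subset if t' then Peak T else Val T]|.
Proof.
move=> lap k0; have [n0|n_gt0] := posnP (ncols la).
  (* The main argument has [m.+1] columns. Without columns no pattern of positive length occurs, and
     [S] is empty. *)
  have noI (i : 'I_(ncols la)) : False by case: i => i; rewrite n0.
  have noC (sg : 'S_k) (T : {set box la}) : contains sg T = false.
    by apply/existsP => -[r /existsP[c _]]; case: (noI (c (Ordinal k0))).
  apply: eq_card => T; rewrite !inE !noC; congr (_ && _).
  by apply/subsetP/subsetP => _ i; case: (noI i).
have En := prednK n_gt0.
have : rows (fun c => count_mem c.+1 la) (ncols la).-1.+1 = la.
  by rewrite En; apply: rows_partition.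
move: En; move: (ncols la).-1 (fun c => count_mem c.+1 la) => m d En E; subst la.
have F := card_sub_PV (esym En) k0; rewrite /PV /pat in F.
by rewrite (F S b t) (F S b' t'); apply: cnt_sub_eq.
Qed.

Theorem theorem1p2 (la : seq nat) (k : nat)
    (la_part : is_partition la) (k_gt0 : 0 < k) :
  [/\ (\sum_(T in avoiders la (Ipat k)) tmon (Peak T)
        = \sum_(T in avoiders la (Ipat k)) tmon (Val T))%R,
      (\sum_(T in avoiders la (Ipat k)) tmon (Val T)
        = \sum_(T in avoiders la (Jpat k)) tmon (Val T))%R
    & (\sum_(T in avoiders la (Jpat k)) tmon (Val T)
        = \sum_(T in avoiders la (Jpat k)) tmon (Peak T))%R].
Proof.
split; apply: sum_tmon_eq => S.
- exact: (@card_PV _ _ S true true true false).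
- exact: (@card_PV _ _ S true false false false).
exact: (@card_PV _ _ S false false false true).
Qed.
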